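(* Let $C_1:f_1=0$ be a reduced curve in $\mathbb{P}^2$ (over $\mathbb{C}$) and let $d_1\leq d_2$ be the two smallest degrees of a minimal system of homogeneous generators for the module of Jacobian syzygies $D_0(f_1)$. Let $C_2:f_2=0$ be a smooth curve in $\mathbb{P}^2$ such that the intersection $C_1\cap C_2$ consists of $\deg C_1\cdot\deg C_2$ points. If $$d_2\leq \deg C_1-2,$$ then the union curve $C=C_1\cup C_2: f=f_1\cdot f_2=0$ satisfies $$t(C)=t(C_1)+\deg C_2.$$ More precisely, if $d_1'\leq d_2'$ denote the two smallest degrees of a minimal system of homogeneous generators for the module of Jacobian syzygies $D_0(f)$, then $$d_1'=d_1+\deg C_2\quad\text{and}\quad d_2'=d_2+\deg C_2\leq \deg C-2.$$
   Context: Let $S=\mathbb{C}[x,y,z]$ with its standard grading. For a reduced curve $C:f=0$ of degree $d$ in $\mathbb{P}^2=\mathbb{P}^2_{\mathbb{C}}$, let $$D_0(f)=\{(a,b,c)\in S^3 : af_x+bf_y+cf_z=0\}$$ be the graded $S$-module of Jacobian syzygies, where a homogeneous element $(a,b,c)$ has degree $k$ if $a,b,c$ are homogeneous of degree $k$. If $d_1\leq d_2\leq\dots\leq d_m$ are the degrees of the elements of a minimal system of homogeneous generators of $D_0(f)$, the type of $C$ is the integer $t(C)=d_1+d_2+1-d$. *)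

(* Defs.v *)
From mathcomp Require Import all_boot all_order all_algebra.
From mathcomp Require Import mpoly complex reals.

Set Implicit Arguments.
Unset Strict Implicit.
Unset Printing Implicit Defensive.

Import GRing.Theory.
Local Open Scope ring_scope.

Section PlaneCurves.
Variable R : realType.

(* The field of complex numbers is [R[i]], for [R] the field of real numbers. *)
Definition Sxyz := {mpoly R[i][3]}.

(* Points of the projective plane are the lines through the origin of C^3. *)
Definition P2 := {V : {vspace 'rV[R[i]]_3} | \dim V == 1%N}.

Definition vanishes_at (f : Sxyz) (P : P2) : Prop :=
  forall v : 'rV[R[i]]_3, v \in val P -> f.@[v 0] = 0.

Definition squarefree (f : Sxyz) : Prop :=
  forall g h : Sxyz, f = g ^+ 2 * h -> exists c : R[i], g = c%:MP.

(* [f != 0] is needed: the zero polynomial is [n.-homog] for every [n]. *)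
Definition reduced_curve (n : nat) (f : Sxyz) : Prop :=
  [/\ (0 < n)%N, f \is n.-homog, f != 0 & squarefree f].

Definition singular_at (f : Sxyz) (P : P2) : Prop :=
  vanishes_at f P /\ forall i : 'I_3, vanishes_at f^`M(i) P.

Definition smooth_curve (n : nat) (f : Sxyz) : Prop :=
  reduced_curve n f /\ forall P : P2, ~ singular_at f P.

Definition meet_in_points (f g : Sxyz) (N : nat) : Prop :=
  exists s : seq P2, [/\ uniq s, size s = N &
    forall P : P2, P \in s <-> vanishes_at f P /\ vanishes_at g P].

Definition jacobian_syzygy (f : Sxyz) (a : 'rV[Sxyz]_3) : Prop :=
  \sum_(i < 3) a 0 i * f^`M(i) = 0.

Definition homog_vector (k : nat) (a : 'rV[Sxyz]_3) : Prop :=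
  forall i : 'I_3, a 0 i \is k.-homog.

Definition generates_D0 (f : Sxyz) (m : nat) (r : 'I_m -> 'rV[Sxyz]_3)
    (J : {set 'I_m}) : Prop :=
  forall a, jacobian_syzygy f a ->
    exists c : 'I_m -> Sxyz, a = \sum_(j in J) c j *: r j.

(* [ds] is the nondecreasing list of the degrees of a minimal system of       *)
(* homogeneous generators of D_0(f); minimality means that no proper          *)
(* subfamily generates.                                                       *)
Definition min_syzygy_degrees (f : Sxyz) (ds : seq nat) : Prop :=
  sorted leq ds /\
  exists r : 'I_(size ds) -> 'rV[Sxyz]_3,
    [/\ forall j : 'I_(size ds), jacobian_syzygy f (r j),
        forall j : 'I_(size ds), homog_vector (nth 0%N ds j) (r j),
        generates_D0 f r [set: 'I_(size ds)] &
        forall J : {set 'I_(size ds)},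
          J \proper [set: 'I_(size ds)] -> ~ generates_D0 f r J].

Definition two_smallest_degrees (f : Sxyz) (d1 d2 : nat) : Prop :=
  exists ds : seq nat, min_syzygy_degrees f [:: d1, d2 & ds].

Definition has_type (n : nat) (f : Sxyz) (t : int) : Prop :=
  exists d1 d2 : nat,
    two_smallest_degrees f d1 d2 /\ t = d1%:Z + d2%:Z + 1 - n%:Z.

End PlaneCurves.

(* Main.v *)
Require Import Defs.
From HB Require Import structures.
From mathcomp Require Import all_boot all_order all_algebra.
From mathcomp Require Import mpoly complex reals.
From mathcomp Require Import perm ring zify.

(** Let a row a = (a1, a2, a3) of forms act on a polynomial f as the derivation
    a(f) = a1 f_x + a2 f_y + a3 f_z, and write E for the Euler derivation
    (x, y, z).  Let n1 and n2 be the degrees of C1 : f1 = 0 and C2 : f2 = 0, and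
    put n = n1 + n2.  If a derivation a kills f1, then

      lift a = f2 a - (a(f2) / n) E

    kills f1 f2, and lift is linear, injective and raises degrees by n2.  The
    point is that lift reaches every syzygy of f1 f2 of degree smaller than
    n - 2: below that degree D_0(f1 f2) is then a copy of D_0(f1) shifted by n2,
    and the bound d2 + n2 <= n - 2 makes this range wide enough to read off the
    two smallest degrees of generators ([first_degrees_union]).  The two degrees
    do not depend on the choice of a minimal system ([first_degrees_uniq]).

    To reach a derivation b that kills f1 f2, note that f2 divides f1 b(f2), hence
    b(f2), because f1 is regular modulo f2.  Subtracting a multiple of E from b
    gives a derivation d of the same degree with d(f1) = 0 and f2 | d(f2), and b
    is a lift as soon as f2 divides d ([lift_syzygy_onto]).  Along the curve C2
    the vector d is orthogonal to both gradients, so it is proportional to their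
    cross product W, whose degree is n - 2.  If W has no zero on C2, then d / W is
    a regular section of negative degree on C2, and it must vanish.  This last
    argument is [divides_of_proportional].  It is carried out by elimination: after
    the choice of a point c off C2, forms become polynomials in Z over K[X, Y] and
    f2 becomes monic in Z.  For general vectors q and q' the ideals (f2, q.W) and
    (f2, q'.W) contain polynomials R and R' of K[X, Y], with R monic in Y, and the
    ideal (R, R') contains a nonzero polynomial x of K[X].  The triangular
    system f2, R, x makes x regular modulo (f2, q.W) ([regular_triple]); as
    x (q.d) lies in that ideal, so does q.d, whose degree is too small for this
    unless f2 divides it.

    It remains to see that W has no zero on C2, that is, that C1 and C2 meet
    transversally ([transversal]).  A zero of W on the smooth curve C2 lies on C1
    by Euler's formula.  Project from a general point: the common points of C1 and
    C2 go to n1 n2 distinct roots of an eliminant of degree at most n1 n2 (the norm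
    of [norm_elimination]).  All these roots are simple, while a point where the
    gradients are proportional would give a double root. *)

Set Implicit Arguments.
Unset Strict Implicit.
Unset Printing Implicit Defensive.
Import GRing.Theory Num.Theory.
Local Open Scope ring_scope.

(** * Gradings on iterated polynomial rings and the norm of a polynomial *)

(** A family of additive subgroups G 0, G 1, ... of a ring with
    G k . G l inside G (k + l).  It carries the bookkeeping of degrees through
    division with remainder and through determinants. *)
Record grading (A : comNzRingType) (G : nat -> A -> Prop) : Prop := Grading {
  grading0 : forall k, G k 0;
  grading1 : G 0%N 1;
  gradingN : forall k x, G k x -> G k (- x);
  gradingD : forall k x y, G k x -> G k y -> G k (x + y);
  gradingM : forall k l x y, G k x -> G l y -> G (k + l)%N (x * y) }.

(** The variable gets weight one: the coefficient of X^i has weight n - i. *)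
Definition poly_grading (A : comNzRingType) (G : nat -> A -> Prop) (n : nat) (p : {poly A}) :=
  forall i, if (i <= n)%N then G (n - i)%N p`_i else p`_i = 0.

Section Grading.
Variable A : comNzRingType.
Variables (G : nat -> A -> Prop) (grG : grading G).

Lemma grading_sum k (I : Type) (r : seq I) (P : pred I) (F : I -> A) :
  (forall i, P i -> G k (F i)) -> G k (\sum_(i <- r | P i) F i).
Proof.
move=> GF; apply: (big_ind (G k)) => //; first exact: grading0.
by move=> x y; apply: gradingD.
Qed.

Lemma grading_prod (I : finType) (d : I -> nat) (F : I -> A) :
  (forall i, G (d i) (F i)) -> G (\sum_i d i)%N (\prod_i F i).
Proof.
move=> GF; apply: (big_rec2 (fun x k => G k x)); first exact: grading1.
by move=> i k x _; apply: gradingM.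
Qed.

Lemma poly_gradingP : grading (poly_grading G).
Proof.
split.
- by move=> k i; rewrite coef0; case: ifP => // _; apply: grading0.
- move=> i; rewrite coefC sub0n leqn0; case: eqP => // _; exact: grading1.
- move=> k p Gp i; have := Gp i; rewrite coefN.
  by case: ifP => _; [apply: gradingN | move=> ->; rewrite oppr0].
- move=> k p q Gp Gq i; have := Gp i; have := Gq i; rewrite coefD.
  case: ifP => _ Gpi Gqi; first exact: gradingD.
  by rewrite Gpi Gqi addr0.
move=> k l p q Gp Gq i; rewrite coefM; case: leqP => [ikl|kli].
  apply: grading_sum => j _; have := Gp j; have := Gq (i - j)%N.
  have lt_ji := ltn_ord j.
  case: leqP => [ijl|_ ->]; last by move=> _; rewrite mulr0; apply: grading0.
  case: leqP => [jk|_ _ ->]; last by rewrite mul0r; apply: grading0.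
  move=> Gq' Gp'; have -> : (k + l - i = (k - j) + (l - (i - j)))%N by lia.
  exact: gradingM.
rewrite big1 // => j _; have := Gp j; have := Gq (i - j)%N.
have lt_ji := ltn_ord j.
case: leqP => [ijl|_ ->]; last by rewrite mulr0.
case: leqP => [jk|_ _ ->]; last by rewrite mul0r.
lia.
Qed.

Lemma poly_grading_size n p : poly_grading G n p -> (size p <= n.+1)%N.
Proof. by move=> Gp; apply/leq_sizeP => j nj; have := Gp j; rewrite leqNgt nj. Qed.

Lemma poly_gradingC k x : G k x -> poly_grading G k x%:P.
Proof.
move=> Gx i; rewrite coefC; case: eqP => [->|_]; first by rewrite subn0.
by case: ifP => // _; apply: grading0.
Qed.

Lemma poly_gradingXn k : poly_grading G k 'X^k.
Proof.
move=> i; rewrite coefXn; case: eqP => [->|_].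
  by rewrite leqnn subnn; apply: grading1.
by case: ifP => // _; apply: grading0.
Qed.

Lemma grading_divp m p n q : p \is monic -> size p = m.+1 ->
    poly_grading G m p -> poly_grading G n q ->
  exists s r, [/\ q = s * p + r, (size r <= m)%N & poly_grading G n r].
Proof.
move=> p_mon szp Gp; have [N leN] := ubnP (size q).
elim: N => // N IH in q leN *; move=> Gq.
have [le_qm|lt_mq] := leqP (size q) m.
  by exists 0, q; split; rewrite // mul0r add0r.
pose k := (size q).-1; have szq : size q = k.+1 by rewrite /k prednK // (leq_ltn_trans _ lt_mq).
have le_kn : (k <= n)%N by have := poly_grading_size Gq; lia.
pose t := (lead_coef q)%:P * 'X^(k - m).
have Gt : poly_grading G (n - m)%N t.
  have -> : (n - m = (n - k) + (k - m))%N by lia.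
  apply: (gradingM poly_gradingP (poly_gradingC _) (poly_gradingXn _)).
  by have := Gq k; rewrite le_kn.
have Gq' : poly_grading G n (q - t * p).
  apply: (gradingD poly_gradingP) => //; apply: (gradingN poly_gradingP).
  have -> : n = (n - m + m)%N by lia.
  exact: (gradingM poly_gradingP).
have sz' : (size (q - t * p)%R <= k)%N.
  apply/leq_sizeP => j le_kj; rewrite coefB.
  have -> : (t * p)`_j = lead_coef q * p`_(j - (k - m)).
    by rewrite -mulrA coefCM coefXnM ifF //; lia.
  move: le_kj; rewrite leq_eqVlt => /predU1P[<-|lt_kj].
    rewrite lead_coefE -/k; have -> : (k - (k - m) = m)%N by lia.
    by move/monicP: p_mon; rewrite lead_coefE szp /= => ->; rewrite mulr1 subrr.
  rewrite (nth_default _ (_ : size q <= j)%N) ?szq // nth_default ?mulr0 ?subr0 // szp.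
  clear -lt_mq lt_kj szq; lia.
have [|s [r [eqr szr Gr]]] := IH (q - t * p) _ Gq'; first lia.
exists (s + t), r; split=> //.
by rewrite mulrDl addrAC -eqr subrK.
Qed.

(** R is the norm of q in the free A-module A[X]/(p): the determinant of
    multiplication by q on the basis 1, X, ..., X^(m - 1).  The first row of the
    adjugate matrix expresses R as a combination of p and q.  The norm, unlike the
    Sylvester resultant, commutes with every specialisation of the coefficients,
    whatever happens to the leading coefficient of q. *)
Lemma norm_elimination m n p q : (0 < m)%N -> p \is monic -> size p = m.+1 ->
    poly_grading G m p -> poly_grading G n q ->
  exists R u v, [/\ G (m * n)%N R, R%:P = u * p + v * q &
    forall (K : closedFieldType) (h : {rmorphism A -> K}), h R = 0 ->
      exists z, root (map_poly h p) z /\ root (map_poly h q) z].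
Proof.
case: m => // m _ p_mon szp Gp Gq.
have /fin_all_exists[s /fin_all_exists[r rP]] : forall i : 'I_m.+1, exists s r,
    [/\ 'X^i * q = s * p + r, (size r <= m.+1)%N & poly_grading G (n + i)%N r].
  move=> i; apply: grading_divp => //.
  rewrite addnC; apply: (gradingM poly_gradingP) => //.
  exact: poly_gradingXn.
pose M := \matrix_(i < m.+1, j < m.+1) (r i)`_j.
have rE i : r i = \sum_(j < m.+1) (M i j)%:P * 'X^j.
  have [_ szr _] := rP i.
  rewrite -[LHS](coefK (r i)) poly_def (big_ord_widen m.+1 (fun j => (r i)`_j *: 'X^j) szr).
  rewrite big_mkcond /=; apply: eq_bigr => j _; rewrite mxE.
  case: ltnP => [_|le_j]; first by rewrite mul_polyC.
  by rewrite nth_default // mul0r.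
exists (\det M), (- \sum_i (\adj M ord0 i)%:P * s i),
  (\sum_i (\adj M ord0 i)%:P * 'X^i); split.
- apply: grading_sum => /= w _; rewrite mulr_sign.
  suff H : G (m.+1 * n)%N (\prod_i M i (w i)).
    by case: (odd_perm w) => //; apply: gradingN.
  have [i lt_i|no_i] := pickP (fun i : 'I_m.+1 => n + i < w i)%N.
    rewrite (bigD1 i) //= mxE; have [_ _ Gr] := rP i.
    by have := Gr (w i); rewrite leqNgt lt_i /= => ->; rewrite mul0r; apply: grading0.
  have bnd i : (w i <= n + i)%N by rewrite leqNgt no_i.
  have -> : (m.+1 * n = \sum_(i < m.+1) (n + i - w i))%N.
    have : (\sum_(i < m.+1) (n + i - w i + w i) = \sum_(i < m.+1) (n + i))%N.
      by apply: eq_bigr => i _; rewrite subnK.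
    rewrite !big_split /= sum_nat_const card_ord.
    by rewrite [X in (_ = _ + X)%N](reindex_inj (@perm_inj _ w)) => /addIn.
  apply: (@grading_prod _ (fun i : 'I_m.+1 => n + i - w i)%N) => i; rewrite mxE; have [_ _ Gr] := rP i.
  by have := Gr (w i); rewrite bnd.
- rewrite mulNr !mulr_suml -sumrN -big_split /=.
  transitivity (\sum_i (\adj M ord0 i)%:P * r i).
    have adjE j : \sum_i \adj M ord0 i * M i j = (\det M) *+ (ord0 == j).
      by have := congr1 (fun N : 'M_m.+1 => N ord0 j) (mul_adj_mx M); rewrite !mxE.
    under [RHS]eq_bigr => i _ do rewrite rE mulr_sumr.
    rewrite exchange_big /=.
    under [RHS]eq_bigr => j _ do under eq_bigr => i _ do rewrite mulrA -polyCM.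
    under [RHS]eq_bigr => j _ do rewrite -mulr_suml -rmorph_sum adjE.
    rewrite (bigD1 ord0) //= mulr1 big1 ?addr0 // => j.
    by rewrite eq_sym => /negPf->; rewrite mul0r.
  apply: eq_bigr => i _; have [eqr _ _] := rP i.
  by rewrite -!mulrA eqr mulrDr addrA addNr add0r.
move=> K h; rewrite -det_map_mx => /eqP/det0P[v v_neq0 vM].
(* A vector of the left kernel of the specialised matrix is a polynomial U of
   degree less than m such that the specialisation of p divides that of U q. *)
pose U := \sum_i (v 0 i)%:P * 'X^i : {poly K}.
have coU (i : 'I_m.+1) : U`_i = v 0 i.
  rewrite coef_sum (bigD1 i) //= coefCM coefXn eqxx mulr1 big1 ?addr0 // => j ij.
  by rewrite coefCM coefXn (inj_eq val_inj) eq_sym (negPf ij) mulr0.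
have szU : (size U <= m.+1)%N.
  apply: (leq_trans (size_sum _ _ _)); apply/bigmax_leqP => i _.
  rewrite mul_polyC (leq_trans (size_scale_leq _ _)) // size_polyXn.
  exact: ltn_ord.
have U_neq0 : U != 0.
  apply: contraNneq v_neq0 => U0; apply/eqP/rowP => i.
  by rewrite -coU U0 coef0 mxE.
have dvdU : map_poly h p %| U * map_poly h q.
  have -> : U * map_poly h q = (\sum_i (v 0 i)%:P * map_poly h (s i)) * map_poly h p.
    rewrite !mulr_suml.
    transitivity (\sum_i ((v 0 i)%:P * map_poly h (s i) * map_poly h p
        + (v 0 i)%:P * map_poly h (r i))).
      apply: eq_bigr => i _; have [eqr _ _] := rP i.
      by rewrite -!mulrA -(map_polyXn h) -rmorphM eqr rmorphD rmorphM mulrDr.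
    rewrite big_split /= -[RHS]addr0; congr (_ + _).
    under eq_bigr => i _ do rewrite rE rmorph_sum mulr_sumr.
    rewrite exchange_big big1 //= => j _.
    under eq_bigr => i _ do rewrite rmorphM /= map_polyC map_polyXn mulrA -polyCM.
    rewrite -mulr_suml -rmorph_sum.
    rewrite [X in X%:P * _](_ : _ = 0) ?mul0r //.
    transitivity ((v *m map_mx h M) 0 j); last by rewrite vM mxE.
    by rewrite !mxE; apply: eq_bigr => i _; rewrite !mxE.
  by rewrite dvdp_mull.
have [cop|] := boolP (coprimep (map_poly h p) (map_poly h q)).
  rewrite mulrC Gauss_dvdpr // in dvdU; have := dvdp_leq U_neq0 dvdU.
  rewrite size_map_poly_id0; last by rewrite (monicP p_mon) rmorph1 oner_neq0.
  by rewrite szp leqNgt ltnS szU.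
rewrite /coprimep => /closed_rootP[z]; rewrite root_gcd => /andP[? ?].
by exists z.
Qed.

End Grading.

(** * Three coordinates *)

(** The indices in the form that the expansion of a sum over 'I_3 produces. *)
Notation o0 := (@ord0 2).
Notation o1 := (lift ord0 ord0 : 'I_3).
Notation o2 := (lift ord0 (lift ord0 ord0) : 'I_3).

Lemma sum_ord3 (V : nmodType) (F : 'I_3 -> V) :
  \sum_(i < 3) F i = F o0 + F o1 + F o2.
Proof. by rewrite !big_ord_recl big_ord0 addr0 addrA. Qed.

Lemma forall_ord3 (P : 'I_3 -> Prop) : P o0 -> P o1 -> P o2 -> forall i, P i.
Proof.
move=> P0 P1 P2 [[|[|[|//]]] lt_i].
- by congr P: P0; apply: val_inj.
- by congr P: P1; apply: val_inj.
- by congr P: P2; apply: val_inj.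
Qed.

(** Used to identify composites of the evaluation maps below. *)
Lemma mpoly_rmorph_ext n (A B : comNzRingType) (f g : {rmorphism {mpoly A[n]} -> B}) :
  (forall c, f c%:MP = g c%:MP) -> (forall i, f 'X_i = g 'X_i) -> f =1 g.
Proof.
move=> fgC fgX; elim/mpolyind => [|c m p _ _ IH]; first by rewrite !rmorph0.
rewrite !rmorphD IH -mul_mpolyC !rmorphM fgC mpolyXE_id !rmorph_prod.
congr (_ * _ + _); apply: eq_bigr => i _.
by rewrite !rmorphXn fgX.
Qed.

(** * Ternary forms in the coordinates of a frame *)

Section PolyEval.
Variables (A B : comNzRingType) (g : {rmorphism A -> B}) (z : B).

Definition poly_eval : {poly A} -> B := horner_eval z \o map_poly g.
HB.instance Definition _ := GRing.RMorphism.on poly_eval.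

Lemma poly_evalE p : poly_eval p = (map_poly g p).[z]. Proof. by []. Qed.

Lemma poly_evalC k : poly_eval k%:P = g k.
Proof. by rewrite poly_evalE map_polyC hornerC. Qed.

Lemma poly_evalX : poly_eval 'X = z.
Proof. by rewrite poly_evalE map_polyX hornerX. Qed.

End PolyEval.

Definition cross (A : comNzRingType) (u v : 'I_3 -> A) : 'I_3 -> A := fun i =>
  if i == o0 then u o1 * v o2 - u o2 * v o1
  else if i == o1 then u o2 * v o0 - u o0 * v o2
  else u o0 * v o1 - u o1 * v o0.

Definition det3 (A : comNzRingType) (a b c : 'I_3 -> A) :=
  a o0 * (b o1 * c o2 - b o2 * c o1)
  + a o1 * (b o2 * c o0 - b o0 * c o2) + a o2 * (b o0 * c o1 - b o1 * c o0).

Section Pencil.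
Variable K : closedFieldType.
Local Notation S := {mpoly K[3]}.
Local Notation K1 := {poly K}.
Local Notation K2 := {poly {poly K}}.
Local Notation K3 := {poly {poly {poly K}}}.
Implicit Types (a b c u v : 'I_3 -> K) (f g : S).

Definition const3 : K -> K3 := polyC \o (polyC \o polyC).
HB.instance Definition _ := GRing.RMorphism.on const3.

(** The form f at the point X a + Y b + Z c, as a polynomial in Z over K[Y] over
    K[X]: the outermost variable moves the point towards c, so that the lines
    through c are the fibres over (X : Y). *)
Definition frame_subst a b c : S -> K3 :=
  mmap const3 (fun i => const3 (a i) * 'X%:P%:P + const3 (b i) * 'X%:P
                      + const3 (c i) * 'X).
HB.instance Definition _ a b c := GRing.RMorphism.on (frame_subst a b c).

Lemma frame_substC a b c k : frame_subst a b c k%:MP = const3 k.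
Proof. by rewrite /frame_subst mmapC. Qed.

Lemma frame_substX a b c i : frame_subst a b c 'X_i
  = const3 (a i) * 'X%:P%:P + const3 (b i) * 'X%:P + const3 (c i) * 'X.
Proof. by rewrite /frame_subst mmapX mmap1U. Qed.

Lemma frame_substM a b c f g :
  frame_subst a b c (f * g) = frame_subst a b c f * frame_subst a b c g.
Proof. exact: rmorphM. Qed.

Lemma frame_substB a b c f g :
  frame_subst a b c (f - g) = frame_subst a b c f - frame_subst a b c g.
Proof. exact: rmorphB. Qed.

(** Typed as a morphism: inferring the morphism structure of a composite over
    iterated polynomial rings is very costly. *)
Definition eval2 (x y : K) : {rmorphism {poly {poly K}} -> K} :=
  poly_eval (horner_eval x) y.

Definition eval3 (x y z : K) : {rmorphism {poly {poly {poly K}}} -> K} :=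
  poly_eval (eval2 x y) z.

Lemma eval2E x y (P : K2) : eval2 x y P = (map_poly (horner_eval x) P).[y].
Proof. by []. Qed.

Lemma eval2C x y (p : K1) : eval2 x y p%:P = p.[x].
Proof. by rewrite eval2E map_polyC hornerC. Qed.

Lemma eval2X x y : eval2 x y 'X = y.
Proof. by rewrite eval2E map_polyX hornerX. Qed.

Lemma eval3E x y z (P : K3) : eval3 x y z P = (map_poly (eval2 x y) P).[z].
Proof. by []. Qed.

Lemma eval3C x y z (P : K2) : eval3 x y z P%:P = eval2 x y P.
Proof. by rewrite eval3E map_polyC hornerC. Qed.

Lemma eval3X x y z : eval3 x y z 'X = z.
Proof. by rewrite eval3E map_polyX hornerX. Qed.

Definition frame_point a b c x y z : 'I_3 -> K := fun i => x * a i + y * b i + z * c i.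

Lemma frame_substE a b c f x y z :
  eval3 x y z (frame_subst a b c f) = f.@[frame_point a b c x y z].
Proof.
have := @mpoly_rmorph_ext _ _ _ (eval3 x y z \o frame_subst a b c)
  (meval (frame_point a b c x y z)).
apply=> [k|i]; rewrite /= /frame_subst.
  by rewrite mmapC mevalC /= /const3 /= eval3C eval2C hornerC.
rewrite mmapX mmap1U mevalXU /frame_point !rmorphD !rmorphM /= /const3 /=.
rewrite !eval3C eval3X !eval2C eval2X !hornerC hornerX.
by rewrite mulrC [b i * y]mulrC [c i * z]mulrC.
Qed.

Definition lin_form u : S := \sum_(i < 3) u i *: 'X_i.

(** The inverse substitution: by Cramer's rule the coordinates of a point p in the
    frame (a, b, c) are the quotients by det (a, b, c) of the determinants
    det (p, b, c), det (a, p, c) and det (a, b, p). *)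
Definition frame_coord a b c : K3 -> S :=
  let D := (det3 a b c)^-1 in
  poly_eval (poly_eval (poly_eval (@mpolyC 3 K)
    (D *: lin_form (cross b c))) (D *: lin_form (cross c a))) (D *: lin_form (cross a b)).
HB.instance Definition _ a b c := GRing.RMorphism.on (frame_coord a b c).

Lemma frame_substK a b c : det3 a b c != 0 ->
  cancel (frame_subst a b c) (frame_coord a b c).
Proof.
move=> D_neq0 f.
have := @mpoly_rmorph_ext _ _ _ (frame_coord a b c \o frame_subst a b c) idfun.
have coordC k : frame_coord a b c (const3 k) = k%:MP.
  by rewrite /frame_coord /const3 /= poly_evalC /= poly_evalC /= poly_evalC.
apply=> [k|i]; rewrite /= /frame_subst ?mmapC ?coordC //.
rewrite mmapX mmap1U !rmorphD !rmorphM /= !coordC /frame_coord.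
rewrite poly_evalX !poly_evalC /= !(poly_evalC, poly_evalX) /= !poly_evalX.
rewrite -!scalerAr -!scalerDr; apply: (scalerI D_neq0).
rewrite scalerA divff // scale1r !mul_mpolyC /lin_form !sum_ord3.
rewrite /det3 /cross /= -!mul_mpolyC.
by elim/forall_ord3: i; rewrite !(rmorphD, rmorphN, rmorphM, rmorphB) /=; ring.
Qed.

(** Constants have weight zero; the gradings built on it are those by the degree
    of a form in X and Y, and in X, Y and Z. *)
Definition const_grading (k : nat) (x : K) := if k == 0%N then True else x = 0.
Definition biform := poly_grading (poly_grading const_grading).
Definition triform := poly_grading biform.

Lemma const_gradingP : grading const_grading.
Proof.
split; rewrite /const_grading => //.
- by move=> k; case: ifP.
- by move=> k x; case: ifP => // _ ->; rewrite oppr0.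
- by move=> k x y; case: ifP => // _ -> ->; rewrite addr0.
move=> [|k] [|l] x y //= => [_ ->|-> _|-> _]; rewrite ?mulr0 ?mul0r //.
Qed.

Lemma biformP : grading biform.
Proof. exact: poly_gradingP (poly_gradingP const_gradingP). Qed.

Lemma triformP : grading triform.
Proof. exact: poly_gradingP biformP. Qed.

Lemma frame_subst_homog a b c n f : f \is n.-homog -> triform n (frame_subst a b c f).
Proof.
move=> /dhomogP fn; rewrite /frame_subst /mmap big_seq.
apply: (grading_sum triformP) => m /fn <-.
have C1 := poly_gradingP const_gradingP.
have tC k : triform 0 (const3 k).
  apply: (poly_gradingC biformP); apply: (poly_gradingC C1).
  exact: (poly_gradingC const_gradingP).
rewrite /= -[mdeg m]add0n; apply: (gradingM triformP) => //; rewrite mdegE.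
apply: (grading_prod triformP) => i.
have tX : triform 1 (const3 (a i) * 'X%:P%:P + const3 (b i) * 'X%:P
                      + const3 (c i) * 'X).
  have mulC k (P : K3) : triform 1 P -> triform 1 (const3 k * P).
    exact: (gradingM triformP (tC k)).
  do 2?apply: (gradingD triformP); apply: mulC.
  - apply: (poly_gradingC biformP); apply: (poly_gradingC C1).
    exact: (poly_gradingXn const_gradingP 1).
  - apply: (poly_gradingC biformP); exact: (poly_gradingXn C1 1).
  - exact: (poly_gradingXn biformP 1).
elim: (m i) => [|k IH]; first exact: (grading1 triformP).
by rewrite exprS -add1n; apply: (gradingM triformP).
Qed.

Lemma grading0_const (A : comNzRingType) (G : nat -> A -> Prop) (p : {poly A}) :
  poly_grading G 0 p -> p = (p`_0)%:P.
Proof. by move=> Gp; apply/size1_polyC/(poly_grading_size Gp). Qed.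

Lemma biform_at0 k P : (0 < k)%N -> biform k P -> eval2 0 0 P = 0.
Proof.
move=> k_gt0 /(_ 0%N); rewrite leq0n subn0 => /(_ 0%N); rewrite leq0n subn0.
rewrite /const_grading eqn0Ngt k_gt0 /= => P00.
by rewrite eval2E horner_coef0 coef_map /= /horner_eval horner_coef0.
Qed.

(** The coefficient of Z^n has weight zero, so it is constant; all other
    coefficients vanish at X = Y = 0, where the value of f is f(c). *)
Lemma frame_subst_lead a b c n f : f \is n.-homog ->
  (frame_subst a b c f)`_n = f.@[c]%:P%:P.
Proof.
move=> fn; have tf := frame_subst_homog a b c fn.
set P := frame_subst a b c f in tf *.
have tfn : biform 0 P`_n by have := tf n; rewrite leqnn subnn.
have /grading0_const kE : poly_grading const_grading 0 (P`_n)`_0.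
  by have := tfn 0%N; rewrite subnn.
have /grading0_const := tfn; rewrite kE; move=> Pn.
rewrite [LHS]Pn; do 2!congr (_%:P).
have := frame_substE a b c f 0 0 1; rewrite -/P.
rewrite (@meval_eq _ _ _ c); last first.
  by move=> i; rewrite /frame_point !mul0r !add0r mul1r.
move=> <-; rewrite eval3E horner_coef.
have szP : (size (map_poly (eval2 0 0) P) <= n.+1)%N.
  exact: leq_trans (size_poly _ _) (poly_grading_size tf).
transitivity (\sum_(i < n.+1) eval2 0 0 P`_i).
  rewrite big_ord_recr /= big1 ?add0r => [|i _].
    by rewrite [in RHS]Pn eval2C hornerC.
  have := tf i; rewrite (ltnW (ltn_ord i)); apply: biform_at0.
  by rewrite subn_gt0.
rewrite [RHS](big_ord_widen n.+1 (fun i => (map_poly (eval2 0 0) P)`_i * 1 ^+ i)) //.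
rewrite [RHS]big_mkcond /=; apply: eq_bigr => i _.
rewrite -(coef_map (eval2 0 0)) expr1n mulr1.
by case: ltnP => // ?; rewrite nth_default.
Qed.

End Pencil.

(* Unification must not unfold these maps when it compares their values. *)
Global Opaque frame_subst frame_coord.

(** * Monic division and a regular sequence *)

Section MonicDivision.
Variable A : idomainType.

Lemma monic_mul_small (F k : {poly A}) :
  F \is monic -> (size (k * F)%R < size F)%N -> k = 0.
Proof.
move=> F_mon; apply: contraTeq => k_neq0.
rewrite -leqNgt size_Mmonic //; have : (0 < size k)%N by rewrite size_poly_gt0.
by case: (size k) => // n _; rewrite addSn /= leq_addl.
Qed.

Lemma monic_div (F p : {poly A}) : F \is monic ->
  exists s r, p = s * F + r /\ (size r < size F)%N.
Proof.
move=> F_mon; exists (Pdiv.Ring.rdivp p F), (Pdiv.Ring.rmodp p F).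
by rewrite -Pdiv.RingMonic.rdivp_eq // Pdiv.Ring.ltn_rmodpN0 ?monic_neq0.
Qed.

(** A nonzero constant is regular modulo a monic polynomial, because the quotient
    ring is a free module. *)
Lemma monic_scale_dvd (F p e : {poly A}) (x : A) : F \is monic -> x != 0 ->
  x%:P * p = e * F -> exists s, p = s * F.
Proof.
move=> F_mon x_neq0 eq_xp; have [s [r [pE lt_r]]] := monic_div p F_mon.
have : (size ((e - x%:P * s) * F)%R < size F)%N.
  suff -> : (e - x%:P * s) * F = x *: r.
    exact: leq_ltn_trans (size_scale_leq _ _) lt_r.
  by rewrite mulrBl -eq_xp pE mulrDr mulrA addrAC subrr add0r mul_polyC.
move/(monic_mul_small F_mon)/eqP; rewrite subr_eq0 => /eqP eE.
exists s; rewrite pE; suff -> : r = 0 by rewrite addr0.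
have : x%:P * r = 0.
  apply: (addrI (x%:P * s * F)); rewrite addr0.
  by rewrite -mulrA -mulrDr -pE eq_xp eE mulrA.
by move/eqP; rewrite mulf_eq0 polyC_eq0 (negPf x_neq0) => /eqP.
Qed.

End MonicDivision.

(** A nonzero x in A is regular modulo (F, W).  Everything is compared with the
    triangular ideal (F, R): after multiplication by v, which turns W into R modulo
    F, and reduction modulo F, the relation reads x r1 = R r2 with coefficients in
    A[Y], and x is regular modulo the monic polynomial R. *)
Lemma regular_triple (A : idomainType) (F W y u v a e : {poly {poly A}})
    (R : {poly A}) (x : A) :
  F \is monic -> R \is monic -> x != 0 -> R%:P = u * F + v * W ->
  x%:P%:P * y = a * W + e * F -> exists k s, y = k * W + s * F.
Proof.
move=> F_mon R_mon x_neq0 RE xyE.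
have [s1 [r1 [vyE lt_r1]]] := monic_div (v * y) F_mon.
have [s2 [r2 [aE lt_r2]]] := monic_div a F_mon.
have eq_r : x%:P%:P * r1 = R%:P * r2.
  apply/eqP; rewrite -subr_eq0; apply/eqP.
  pose k := R%:P * s2 - a * u + v * e - x%:P%:P * s1.
  have kE : x%:P%:P * r1 - R%:P * r2 = k * F.
    have -> : r1 = v * y - s1 * F by rewrite vyE addrC addKr.
    have -> : r2 = a - s2 * F by rewrite [in RHS]aE addrC addKr.
    have -> : x%:P%:P * (v * y - s1 * F)
        = v * (x%:P%:P * y) - x%:P%:P * s1 * F by ring.
    by rewrite xyE /k RE; ring.
  have : (size (k * F)%R < size F)%N.
    rewrite -kE !mul_polyC (leq_ltn_trans (size_polyD _ _)) // size_polyN gtn_max.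
    by rewrite !(leq_ltn_trans (size_scale_leq _ _)).
  by rewrite kE => /(monic_mul_small F_mon)->; rewrite mul0r.
have /fin_all_exists[k kE] : forall i : 'I_(size r1), exists s, r1`_i = s * R.
  move=> i; apply: (@monic_scale_dvd _ R r1`_i r2`_i x) => //.
  by have := congr1 (fun p : {poly {poly A}} => p`_i) eq_r; rewrite !coefCM mulrC => ->; rewrite mulrC.
pose k' : {poly {poly A}} := \sum_i (k i)%:P * 'X^i.
have r1E : r1 = R%:P * k'.
  rewrite -[LHS]coefK poly_def mulr_sumr; apply: eq_bigr => i _.
  by rewrite kE -[LHS]mul_polyC polyCM; ring.
have : R%:P * (y - k' * W) = (u * y + s1 * W) * F.
  have -> : R%:P * (y - k' * W) = R%:P * y - W * (R%:P * k') by ring.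
  rewrite -r1E; have -> : r1 = v * y - s1 * F by rewrite vyE addrC addKr.
  by rewrite RE; ring.
case/monic_scale_dvd => // [|s sE]; first exact: monic_neq0.
by exists k', s; rewrite -sE addrC subrK.
Qed.

(** * Points in general position *)

Section Avoid.
Variable K : closedFieldType.
Local Notation S := {mpoly K[3]}.

Lemma exists_nonroot (p : {poly K}) : p != 0 -> exists x, p.[x] != 0.
Proof. by move/closed_nonrootP. Qed.

Definition std_vec (i j : 'I_3) : K := (i == j)%:R.

Lemma frame_subst_neq0 a b c (f : S) : det3 a b c != 0 -> f != 0 ->
  frame_subst a b c f != 0.
Proof.
move=> D_neq0; apply: contraNneq => f0.
by rewrite -(frame_substK D_neq0 f) f0 rmorph0.
Qed.

(** One variable at a time, keeping a leading coefficient nonzero. *)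
Lemma exists_nonzero_eval (P : {poly {poly {poly K}}}) : P != 0 ->
  exists x y z, eval3 x y z P != 0.
Proof.
move=> P_neq0.
have map_neq0 (A : nzRingType) (h : {rmorphism A -> K}) (p : {poly A}) :
    h (lead_coef p) != 0 -> exists z, (map_poly h p).[z] != 0.
  move=> hp; apply: exists_nonroot.
  by apply: contraNneq hp => p0; rewrite lead_coefE -coef_map p0 coef0.
have [|x Hx] := @exists_nonroot (lead_coef (lead_coef P)).
  by rewrite !lead_coef_eq0.
have [y Hy] := map_neq0 _ (horner_eval x) _ Hx.
by have [z Hz] := map_neq0 _ (eval2 x y) _ Hy; exists x, y, z.
Qed.

Lemma exists_nonzero_point (f : S) : f != 0 -> exists v, f.@[v] != 0.
Proof.
move=> f_neq0.
have D1 : det3 (std_vec o0) (std_vec o1) (std_vec o2) != 0.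
  by rewrite /det3 /std_vec /= !(mulr0, mul0r, subr0, addr0, mulr1) oner_neq0.
have [x [y [z]]] := exists_nonzero_eval (frame_subst_neq0 D1 f_neq0).
by rewrite frame_substE; exists (frame_point (std_vec o0) (std_vec o1) (std_vec o2) x y z).
Qed.

Lemma exists_generic_point (fs : seq S) : all (fun f => f != 0) fs ->
  exists v, all (fun f => f.@[v] != 0) fs.
Proof.
move=> fs_neq0; have /exists_nonzero_point[v] : \prod_(f <- fs) f != 0.
  by rewrite prodf_seq_neq0.
rewrite rmorph_prod prodf_seq_neq0 => H; exists v.
by move: H; elim: fs {fs_neq0} => //= f fs IH /andP[-> /IH].
Qed.

Lemma lin_formE (u v : 'I_3 -> K) : (lin_form u).@[v] = \sum_(i < 3) u i * v i.
Proof.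
by rewrite /lin_form rmorph_sum; apply: eq_bigr => i _; rewrite /= mevalZ mevalXU.
Qed.

Lemma lin_form_neq0 (u : 'I_3 -> K) i : u i != 0 -> lin_form u != 0.
Proof.
move=> ui; apply/eqP => /(congr1 (meval (std_vec i))).
rewrite lin_formE rmorph0 (bigD1 i) //= big1 => [|j]; rewrite /std_vec.
  by rewrite eqxx mulr1 addr0 => /eqP; rewrite (negPf ui).
by rewrite eq_sym => /negPf->; rewrite mulr0.
Qed.

End Avoid.

(** * Divisibility and degree of ternary forms *)

Section Homogeneous.
Variable K : closedFieldType.
Local Notation S := {mpoly K[3]}.
Implicit Types (f g : S) (u v : 'I_3 -> K).

Definition divides g f := exists s, f = s * g.

Lemma meval_homog n f k v w : f \is n.-homog -> (forall i, w i = k * v i) ->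
  f.@[w] = k ^+ n * f.@[v].
Proof.
move=> /dhomogP fn wE; rewrite !mevalE mulr_sumr big_seq [RHS]big_seq.
apply: eq_bigr => m /fn /= <-; rewrite mulrCA; congr (_ * _).
rewrite mdegE expr_sum -big_split /=; apply: eq_bigr => i _.
by rewrite wE exprMn.
Qed.

(** This makes the coefficients homogeneous when a form is written as a combination
    of forms. *)
Lemma pihomogM n e g s : g \is n.-homog ->
  pihomog mdeg e (s * g) = if (n <= e)%N then pihomog mdeg (e - n) s * g else 0.
Proof.
move=> gn; pose k := (msize s + e).+1.
rewrite {1}(@pihomog_partitionE _ _ mdeg k s); last by rewrite /k; lia.
have gk d : pihomog mdeg d s * g \is (d + n).-homog.
  by apply: dhomogM => //; apply: pihomogP.
rewrite mulr_suml linear_sum /=; case: leqP => [le_ne|lt_en].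
  have lt_k : (e - n < k)%N by rewrite /k; lia.
  rewrite (bigD1 (Ordinal lt_k)) //= big1 ?addr0 => [|d].
    by apply: pihomog_dE; have := gk (e - n)%N; rewrite subnK.
  rewrite -(inj_eq val_inj) /= => ne_d; apply: (pihomog_ne0 _ (gk d)).
  by apply: contraNneq ne_d => <-; rewrite addnK.
rewrite big1 // => d _; apply: (pihomog_ne0 _ (gk d)).
by apply: contraTneq lt_en => <-; rewrite -leqNgt leq_addl.
Qed.

Lemma triform_monic n (a b c : 'I_3 -> K) g : g \is n.-homog -> g.@[c] = 1 ->
  frame_subst a b c g \is monic /\ size (frame_subst a b c g) = n.+1.
Proof.
move=> gn gc; have := frame_subst_lead a b c gn; rewrite gc => lead1.
have sz : size (frame_subst a b c g) = n.+1.
  apply/eqP; rewrite eqn_leq (poly_grading_size (frame_subst_homog a b c gn)) /=.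
  by rewrite ltnNge; apply/negP => /leq_sizeP/(_ n (leqnn n)) /eqP; rewrite lead1 !polyC1 oner_eq0.
by split=> //; rewrite monicE lead_coefE sz /= lead1 !polyC1.
Qed.

Lemma divides_frame a b c f g : det3 a b c != 0 ->
  (exists s, frame_subst a b c f = s * frame_subst a b c g) -> divides g f.
Proof.
move=> D_neq0 [s sE]; exists (frame_coord a b c s).
by rewrite -[LHS](frame_substK D_neq0) sE rmorphM /= frame_substK.
Qed.

End Homogeneous.

(** * Elimination along the lines through a point *)

Section Elimination.
Variable K : closedFieldType.
Local Notation S := {mpoly K[3]}.
Implicit Types (f g : S) (a b c : 'I_3 -> K).

Lemma frame_elimination a b c m n g f : (0 < m)%N -> g \is m.-homog ->
    g.@[c] = 1 -> f \is n.-homog ->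
  exists R u v, [/\ biform (m * n) R,
    R%:P = u * frame_subst a b c g + v * frame_subst a b c f &
    forall x y, eval2 x y R = 0 -> exists z,
      g.@[frame_point a b c x y z] = 0 /\ f.@[frame_point a b c x y z] = 0].
Proof.
move=> m_gt0 gm gc fn; have [g_mon szg] := triform_monic a b gm gc.
have [R [u [v [RG RE Rroot]]]] := norm_elimination (@biformP K) m_gt0 g_mon szg
  (frame_subst_homog a b c gm) (frame_subst_homog a b c fn).
exists R, u, v; split=> // x y /Rroot[z [/rootP gz /rootP fz]].
exists z; move: gz fz; rewrite -!eval3E !frame_substE.
exact: conj.
Qed.

(** A form f without common zero with g on one line through c is regular modulo g:
    its eliminant is then nonzero, and nonzero elements of K[X, Y] are regular
    modulo the monic polynomial that g becomes. *)
Lemma divides_cancel a b c m n g f h x y : (0 < m)%N -> g \is m.-homog ->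
    g.@[c] = 1 -> f \is n.-homog -> det3 a b c != 0 ->
    (forall z, g.@[frame_point a b c x y z] = 0 ->
       f.@[frame_point a b c x y z] <> 0) ->
  divides g (f * h) -> divides g h.
Proof.
move=> m_gt0 gm gc fn D_neq0 no_zero [s fhE].
have [R [u [v [_ RE Rroot]]]] := frame_elimination a b m_gt0 gm gc fn.
have [g_mon _] := triform_monic a b gm gc.
have R_neq0 : R != 0.
  apply/eqP => R0; have [|z [gz fz]] := Rroot x y; first by rewrite R0 rmorph0.
  exact: no_zero gz fz.
apply: (divides_frame D_neq0); apply: (monic_scale_dvd g_mon R_neq0
  (e := u * frame_subst a b c h + v * frame_subst a b c s)).
have := congr1 (frame_subst a b c) fhE; rewrite !frame_substM RE.
move: (frame_subst a b c f) (frame_subst a b c g) (frame_subst a b c h)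
  (frame_subst a b c s) => F G H T FH.
by rewrite !mulrDl; congr (_ + _); [rewrite mulrAC|rewrite -!mulrA FH].
Qed.

(** The value at (0 : 1) of a form of degree N in X and Y is its coefficient of
    Y^N, which is the leading one if it is not zero. *)
Lemma biform_monic N (R : {poly {poly K}}) : biform N R -> eval2 0 1 R != 0 ->
  exists k, [/\ k != 0, k%:P%:P * R \is monic & size (k%:P%:P * R) = N.+1].
Proof.
move=> RN R01; have := RN N; rewrite leqnn subnn => /grading0_const; set k := _`_0 => RNE.
have k_neq0 : k != 0.
  apply: contraNneq R01 => k0; rewrite eval2E horner_coef big1 // => i _.
  rewrite expr1n mulr1 coef_map /= /horner_eval horner_coef0.
  have [lt_iN|] := ltnP i N; last first.
    rewrite leq_eqVlt => /predU1P[<-|lt_Ni]; first by rewrite RNE k0 coef0.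
    by have := RN i; rewrite leqNgt lt_Ni /= => ->; rewrite coef0.
  have := RN i; rewrite (ltnW lt_iN) => /(_ 0%N); rewrite leq0n subn0.
  by rewrite /const_grading subn_eq0 leqNgt lt_iN.
exists k^-1; have coN : (k^-1%:P%:P * R)`_N = 1.
  by rewrite coefCM RNE -polyCM mulVf.
have sz : size (k^-1%:P%:P * R) = N.+1.
  apply/eqP; rewrite eqn_leq; apply/andP; split.
    rewrite mul_polyC (leq_trans (size_scale_leq _ _)) //.
    exact: poly_grading_size RN.
  by rewrite ltnNge; apply/negP => /leq_sizeP/(_ N (leqnn N))/eqP; rewrite coN oner_eq0.
by split=> //; [rewrite invr_eq0|rewrite monicE lead_coefE sz coN].
Qed.

Definition roots (p : {poly K}) : seq K := sval (closed_field_poly_normal p).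

Lemma mem_roots (p : {poly K}) x : p \is monic -> (x \in roots p) = root p x.
Proof.
move=> /monicP p_mon; rewrite /roots; case: closed_field_poly_normal => rs /= ->.
by rewrite p_mon scale1r root_prod_XsubC.
Qed.

Lemma frame_exists c i : c i != 0 -> exists a b, det3 a b c != 0.
Proof.
elim/forall_ord3: i => ci.
- exists (@std_vec K o1), (@std_vec K o2).
  by rewrite /det3 /std_vec /= !(mulr0, mul0r, mul1r, mulr1, sub0r, subr0, addr0, add0r) ?oppr_eq0.
- exists (@std_vec K o0), (@std_vec K o2).
  by rewrite /det3 /std_vec /= !(mulr0, mul0r, mul1r, mulr1, sub0r, subr0, addr0, add0r) ?oppr_eq0.
exists (@std_vec K o0), (@std_vec K o1).
by rewrite /det3 /std_vec /= !(mulr0, mul0r, mul1r, mulr1, sub0r, subr0, addr0, add0r).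
Qed.

End Elimination.

(** * Vectors of forms that are proportional along a curve *)

Lemma all_flatten (T : Type) (P : pred T) (ss : seq (seq T)) :
  all P (flatten ss) = all (all P) ss.
Proof. by elim: ss => //= s ss IH; rewrite all_cat IH. Qed.

(** If y / W = y' / W' modulo F, then W divides y modulo F, provided F, W and W'
    have no common zero in the sense that (F, W, W') contains a nonzero x in A. *)
Lemma regular_combination (A : idomainType)
    (F W W' y y' s u v u' v' : {poly {poly A}}) (R R' k al be : {poly A}) (x : A) :
  F \is monic -> k * R \is monic -> x != 0 -> R%:P = u * F + v * W ->
  R'%:P = u' * F + v' * W' -> x%:P = al * (k * R) + be * R' ->
  y * W' - y' * W = s * F -> exists l t, y = l * W + t * F.
Proof.
move=> F_mon R_mon x_neq0 RE R'E xE yE.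
apply: (@regular_triple A F W y (k%:P * u) (k%:P * v)
  (al%:P * k%:P * v * y + be%:P * v' * y')
  (al%:P * k%:P * u * y + be%:P * u' * y + be%:P * v' * s)
  (k * R) x F_mon R_mon x_neq0).
  by rewrite polyCM RE; ring.
rewrite xE polyCD !polyCM RE R'E.
have -> : (al%:P * (k%:P * (u * F + v * W)) + be%:P * (u' * F + v' * W')) * y
  = al%:P * k%:P * (u * F + v * W) * y + be%:P * u' * F * y
   + be%:P * v' * (y * W' - y' * W) + be%:P * v' * y' * W by ring.
by rewrite yE; ring.
Qed.

Section Proportional.
Variable K : closedFieldType.
Local Notation S := {mpoly K[3]}.
Implicit Types (f g : S) (a b c : 'I_3 -> K).

Lemma exists_nth_root n (x : K) : (0 < n)%N -> exists y, y ^+ n = x.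
Proof.
move=> n_gt0; have /closed_rootP[y] : size ('X^n - x%:P) != 1%N.
  by rewrite size_XnsubC // eqSS -lt0n.
by rewrite rootE !hornerE subr_eq0 => /eqP; exists y.
Qed.

(** By homogeneity a point off the curve can be rescaled so that g takes the value
    one there, which makes g monic in Z in every frame that ends with this point. *)
Lemma exists_normalized_point m g (us : seq ('I_3 -> K)) : (0 < m)%N ->
    g \is m.-homog -> g != 0 -> all (fun u => lin_form u != 0) us ->
  exists c, g.@[c] = 1 /\ all (fun u => (lin_form u).@[c] != 0) us.
Proof.
move=> m_gt0 gm g_neq0 us_neq0.
have [|c] := @exists_generic_point K (g :: map (@lin_form K) us).
  by rewrite /= g_neq0 all_map.
rewrite /= all_map => /andP[gc usc].
have [y yE] := exists_nth_root g.@[c]^-1 m_gt0.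
have y_neq0 : y != 0.
  apply: contraNneq gc => y0; rewrite -invr_eq0 -yE y0 expr0n.
  by rewrite eqn0Ngt m_gt0.
exists (fun i => y * c i); split.
  by rewrite (@meval_homog _ m g y c) // yE mulVf.
apply: sub_all usc => u /=; rewrite !lin_formE.
have -> : \sum_(i < 3) u i * (y * c i) = y * \sum_(i < 3) u i * c i.
  by rewrite mulr_sumr; apply: eq_bigr => i _; rewrite mulrCA.
by rewrite mulf_eq0 negb_or y_neq0.
Qed.

Lemma normalized_nonzero m g c : (0 < m)%N -> g \is m.-homog -> g.@[c] = 1 ->
  exists i, c i != 0.
Proof.
move=> m_gt0 gm gc.
have [c0|?] := eqVneq (c o0) 0; last by exists o0.
have [c1|?] := eqVneq (c o1) 0; last by exists o1.
have [c2|?] := eqVneq (c o2) 0; last by exists o2.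
have := oner_neq0 K; rewrite -gc (@meval_homog _ m g 0 (fun=> 0)) //.
  by rewrite expr0n eqn0Ngt m_gt0 mul0r eqxx.
by apply: forall_ord3; rewrite mul0r.
Qed.

Lemma divides_lincomb g (q : 'I_3 -> K) (F : 'I_3 -> S) :
  (forall i, divides g (F i)) -> divides g (\sum_(i < 3) q i *: F i).
Proof.
move=> /fin_all_exists[s sE]; exists (\sum_(i < 3) q i *: s i).
by rewrite mulr_suml; apply: eq_bigr => i _; rewrite sE scalerAl.
Qed.

Definition dot (q : 'I_3 -> K) (W : 'I_3 -> S) : S := \sum_(i < 3) q i *: W i.

Lemma dot_homog n q W : (forall i, W i \is n.-homog) -> dot q W \is n.-homog.
Proof. by move=> Wn; apply: rpred_sum => i _; apply: rpredZ. Qed.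

Lemma dotE q W v : (dot q W).@[v] = (lin_form (fun i => (W i).@[v])).@[q].
Proof.
rewrite lin_formE /dot rmorph_sum; apply: eq_bigr => i _ /=.
by rewrite mevalZ mulrC.
Qed.

Lemma exists_dot_nonzero (W : 'I_3 -> S) (vs : seq ('I_3 -> K)) :
    all (fun v => [exists i, (W i).@[v] != 0]) vs ->
  exists q, all (fun v => (dot q W).@[v] != 0) vs.
Proof.
move=> Wvs; have [|q] := @exists_generic_point K
    [seq lin_form (fun i => (W i).@[v]) | v <- vs].
  rewrite all_map; apply: sub_all Wvs => v /existsP[j].
  exact: lin_form_neq0.
rewrite all_map => q_vs; exists q; apply: sub_all q_vs => v /=.
by rewrite dotE.
Qed.

Lemma frame_coordE a b c x y z :
  [/\ det3 (frame_point a b c x y z) b c = x * det3 a b c,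
      det3 a (frame_point a b c x y z) c = y * det3 a b c &
      det3 a b (frame_point a b c x y z) = z * det3 a b c].
Proof. by rewrite /det3 /frame_point; split; ring. Qed.

Lemma det3_neq0 a b c : det3 a b c != 0 ->
  [/\ exists i, a i != 0, exists i, b i != 0 & exists i, c i != 0].
Proof.
have ex0 (v : 'I_3 -> K) : (exists i, v i != 0) \/ [/\ v o0 = 0, v o1 = 0 & v o2 = 0].
  have [?|] := eqVneq (v o0) 0; last by left; exists o0.
  have [?|] := eqVneq (v o1) 0; last by left; exists o1.
  have [?|] := eqVneq (v o2) 0; last by left; exists o2.
  by right.
move=> D; split.
- have [//|[a0 a1 a2]] := ex0 a; case/eqP: D; rewrite /det3 a0 a1 a2; ring.
- have [//|[a0 a1 a2]] := ex0 b; case/eqP: D; rewrite /det3 a0 a1 a2; ring.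
- have [//|[a0 a1 a2]] := ex0 c; case/eqP: D; rewrite /det3 a0 a1 a2; ring.
Qed.

Definition line_zeros a b c g x y : seq K :=
  roots (map_poly (eval2 x y) (frame_subst a b c g)).

Lemma mem_line_zeros m g a b c x y z : g \is m.-homog -> g.@[c] = 1 ->
  (z \in line_zeros a b c g x y) = (g.@[frame_point a b c x y z] == 0).
Proof.
move=> gm gc; have [g_mon _] := triform_monic a b gm gc.
by rewrite mem_roots ?monic_map // -(frame_substE a b c g).
Qed.

(** The quotient of d by W is a section of negative degree on the curve g = 0,
    regular because W has no zero on this curve. *)
Theorem divides_of_proportional m w e g (W d : 'I_3 -> S) :
    (0 < m)%N -> g \is m.-homog -> g != 0 ->
    (forall i, W i \is w.-homog) -> (forall i, d i \is e.-homog) -> (e < w)%N ->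
    (forall v i, v i != 0 -> g.@[v] = 0 -> exists j, (W j).@[v] != 0) ->
    (forall i j, divides g (d i * W j - d j * W i)) ->
  forall i, divides g (d i).
Proof.
move=> m_gt0 gm g_neq0 Ww de lt_ew Wnz dW.
have [c [gc _]] := @exists_normalized_point m g [::] m_gt0 gm g_neq0 isT.
have [i0 ci0] := normalized_nonzero m_gt0 gm gc.
have [a [b D_neq0]] := frame_exists ci0.
have pt_neq0 x y z : (x != 0) || (y != 0) -> exists i, frame_point a b c x y z i != 0.
  have [Ex Ey _] := frame_coordE a b c x y z.
  case/orP=> [x0|y0].
    have /det3_neq0[//] : det3 (frame_point a b c x y z) b c != 0.
    by rewrite Ex mulf_neq0.
  have /det3_neq0[] // : det3 a (frame_point a b c x y z) c != 0.
  by rewrite Ey mulf_neq0.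
have zerosE x y z := mem_line_zeros a b x y z gm gc.
have line_pts x y : (x != 0) || (y != 0) ->
    all (fun v => [exists j, (W j).@[v] != 0])
      [seq frame_point a b c x y z | z <- line_zeros a b c g x y].
  move=> xy_neq0; rewrite all_map; apply/allP => z /=; rewrite zerosE => /eqP gz.
  by have [i nz] := pt_neq0 x y z xy_neq0; apply/existsP; apply: (Wnz _ i nz).
(* The vector q avoids the zeros of W on the line X = 0: thus q.W is regular
   modulo g and its eliminant R1 contains a pure power of Y. *)
have [|q] := @exists_dot_nonzero W [seq frame_point a b c 0 1 z | z <- line_zeros a b c g 0 1].
  by apply: line_pts; rewrite oner_eq0 orbT.
rewrite all_map => /allP qP.
have qw := dot_homog q Ww.
have q_line z : g.@[frame_point a b c 0 1 z] = 0 -> (dot q W).@[frame_point a b c 0 1 z] <> 0.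
  by move=> /eqP; rewrite -zerosE => /qP/eqP.
have [R1 [u1 [v1 [R1N R1E R1root]]]] := frame_elimination a b m_gt0 gm gc qw.
have [k [k_neq0 R_mon szR]] : exists k,
    [/\ k != 0, k%:P%:P * R1 \is monic & size (k%:P%:P * R1) = (m * w).+1].
  apply: biform_monic => //; apply/eqP => /R1root[z [gz qz]].
  exact: (q_line z).
set R := k%:P%:P * R1 in R_mon szR.
have RN : biform (m * w) R.
  rewrite -[(m * w)%N]add0n; apply: (gradingM (biformP K)) => //.
  apply: (poly_gradingC (poly_gradingP (const_gradingP K))).
  exact: (poly_gradingC (const_gradingP K)).
(* The vector q' avoids the finitely many points of the curve over the roots of R
   on the line X = 1, so that R and the eliminant R3 of q'.W have no common root
   there, and their own eliminant x does not vanish at X = 1. *)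
pose ts := roots (map_poly (horner_eval 1) R).
have [|q'] := @exists_dot_nonzero W
    (flatten [seq [seq frame_point a b c 1 t z | z <- line_zeros a b c g 1 t] | t <- ts]).
  rewrite all_flatten all_map; apply/allP => t _ /=.
  by apply: line_pts; rewrite oner_eq0.
rewrite all_flatten all_map => /allP /= q'P.
have q'w := dot_homog q' Ww.
have [R3 [u3 [v3 [R3N R3E R3root]]]] := frame_elimination a b m_gt0 gm gc q'w.
have [x [al [be [_ xE xroot]]]] : exists x al be, [/\ poly_grading (@const_grading K) (m * w * (m * w)) x,
    x%:P = al * R + be * R3 &
  forall (L : closedFieldType) (h : {rmorphism {poly K} -> L}), h x = 0 ->
      exists z, root (map_poly h R) z /\ root (map_poly h R3) z].
  apply: (norm_elimination (poly_gradingP (const_gradingP K))) => //.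
  by rewrite muln_gt0 m_gt0 (leq_ltn_trans _ lt_ew).
have x_neq0 : x != 0.
  apply/eqP => x0; have [|t [Rt R3t]] := xroot K (horner_eval 1).
    by rewrite x0 rmorph0.
  have [|z [gz qz]] := R3root 1 t; first exact/eqP.
  have /q'P : t \in ts by rewrite mem_roots // monic_map.
  rewrite all_map => /allP/(_ z); rewrite zerosE gz eqxx => /(_ isT) /=.
  by rewrite qz eqxx.
have dotW j : divides g (dot q d * W j - d j * dot q W).
  rewrite /dot mulr_suml mulr_sumr -sumrB.
  under eq_bigr => i _ do rewrite -scalerAl -scalerAr -scalerBr.
  exact: divides_lincomb.
(* Since q.d / q.W = q'.d / q'.W along the curve, q.W divides q.d modulo g; the
   degree of q.d is too small for this unless q.d vanishes modulo g. *)
have divD : divides g (dot q d).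
  have [s sE] : exists s, dot q d * dot q' W - dot q' d * dot q W = s * g.
    have -> : dot q d * dot q' W - dot q' d * dot q W
        = \sum_(i < 3) q' i *: (dot q d * W i - d i * dot q W).
      rewrite [dot q' W]/dot [dot q' d]/dot mulr_sumr mulr_suml -sumrB.
      by apply: eq_bigr => i _; rewrite scalerBr scalerAr scalerAl.
    exact: divides_lincomb dotW.
  have [l [t tE]] : exists l t, frame_subst a b c (dot q d)
      = l * frame_subst a b c (dot q W) + t * frame_subst a b c g.
    have [g_mon _] := triform_monic a b gm gc.
    have := congr1 (frame_subst a b c) sE; rewrite frame_substB !frame_substM.
    exact: (regular_combination g_mon R_mon x_neq0 R1E R3E xE).
  have fE : dot q d = frame_coord a b c l * dot q W + frame_coord a b c t * g.
    by rewrite -[LHS](frame_substK D_neq0) tE rmorphD !rmorphM /= !frame_substK.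
  have := congr1 (pihomog mdeg e) fE; rewrite (pihomog_dE (dot_homog q de)) => ->.
  rewrite linearD /= (pihomogM _ _ qw) leqNgt lt_ew add0r (pihomogM _ _ gm).
  by case: ifP => _; [eexists | exists 0; rewrite mul0r].
move=> j; apply: (divides_cancel m_gt0 gm gc qw D_neq0 q_line).
have [s sE] := dotW j; have [t tE] := divD.
exists (t * W j - s); rewrite mulrBl -sE -mulrA [W j * g]mulrC mulrA -tE.
by rewrite opprB addrC subrK mulrC.
Qed.

End Proportional.

(** * Differential calculus of forms *)

Section Calculus.
Variable A : comNzRingType.
Variable n : nat.
Local Notation S := {mpoly A[n]}.

Lemma mpoly_alg_ind (P : S -> Prop) :
    (forall c, P c%:MP) -> (forall i, P 'X_i) ->
    (forall f g, P f -> P g -> P (f + g)) ->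
    (forall f g, P f -> P g -> P (f * g)) ->
  forall f, P f.
Proof.
move=> PC PX PD PM; elim/mpolyind => [|c m p _ _ IH].
  by rewrite -(mpolyC0 n A); apply: PC.
apply: PD => //; rewrite -mul_mpolyC; apply: (PM) => //.
have P1 : P 1 by rewrite -(mpolyC1 n A); apply: PC.
rewrite mpolyXE_id; apply: (big_ind P) => [//|f g|i _]; first exact: PM.
by elim: (m i) => [|k IHk]; rewrite ?expr0 // exprS; apply: PM.
Qed.

(** The restriction of f to the parametrised line v + t d. *)
Definition along (v d : 'I_n -> A) : S -> {poly A} :=
  mmap polyC (fun i => (v i)%:P + (d i)%:P * 'X).
HB.instance Definition _ v d := GRing.RMorphism.on (along v d).

Lemma alongC v d k : along v d k%:MP = k%:P.
Proof. by rewrite /along mmapC. Qed.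

Lemma alongX v d i : along v d 'X_i = (v i)%:P + (d i)%:P * 'X.
Proof. by rewrite /along mmapX mmap1U. Qed.

Lemma along_at0 v d f : (along v d f).[0] = f.@[v].
Proof.
elim/mpoly_alg_ind: f => [k|i|f g IHf IHg|f g IHf IHg].
- by rewrite alongC hornerC mevalC.
- by rewrite alongX mevalXU !hornerE ?mulr0 ?addr0.
- by rewrite !rmorphD hornerD IHf IHg.
by rewrite !rmorphM hornerM IHf IHg.
Qed.

(** Both sides are derivations at v with the same values on the coordinates. *)
Lemma along_deriv v d f :
  (along v d f)^`().[0] = \sum_(i < n) d i * (f^`M(i)).@[v].
Proof.
elim/mpoly_alg_ind: f => [k|i|f g IHf IHg|f g IHf IHg].
- rewrite alongC derivC horner0 big1 // => i _.
  by rewrite mderivC meval0 mulr0.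
- rewrite alongX derivD derivC add0r derivM derivC mul0r add0r derivX mulr1 hornerC.
  rewrite (bigD1 i) //= big1 => [|j]; rewrite mderivX mnm1E.
    have -> : (U_(i) - U_(i))%MM = 0%MM :> 'X_{1..n}.
      by apply/mnmP => l; rewrite mnmBE subnn mnm0E.
    by rewrite eqxx scale1r mpolyX0 meval1 mulr1 addr0.
  by move=> /negPf; rewrite eq_sym => ->; rewrite scale0r meval0 mulr0.
- rewrite !rmorphD derivD hornerD IHf IHg -big_split.
  by apply: eq_bigr => i _; rewrite mderivD rmorphD mulrDr.
rewrite !rmorphM derivM hornerD !hornerM IHf IHg !along_at0 mulr_suml mulr_sumr -big_split.
by apply: eq_bigr => i _; rewrite mderivM rmorphD !rmorphM mulrDr /=; ring.
Qed.

Lemma euler_formula k (f : S) : f \is k.-homog ->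
  \sum_(i < n) 'X_i * f^`M(i) = k%:R * f.
Proof.
move=> /dhomogP fk; rewrite [in RHS](mpolyE f) mulr_sumr.
transitivity (\sum_(i < n) \sum_(m <- msupp f) f@_m *: ((m i)%:R *: 'X_[m])).
  apply: eq_bigr => i _; rewrite {1}(mpolyE f) raddf_sum mulr_sumr /=.
  apply: eq_bigr => m _; rewrite mderivZ mderivX -!scalerAr; congr (_ *: _).
  have [->|mi] := eqVneq (m i) 0%N; first by rewrite !scale0r.
  congr (_ *: _); rewrite -mpolyXD addmC submK //.
  apply/mnm_lepP => j; rewrite mnmE; case: eqP => // <-.
  by rewrite lt0n.
rewrite exchange_big big_seq [RHS]big_seq; apply: eq_bigr => m /fk /= <-.
rewrite -scaler_sumr -scaler_suml mdegE -scalerAr; congr (_ *: _).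
by rewrite -natr_sum scaler_nat mulr_natl.
Qed.

Lemma mderiv_homog k (f : S) i : f \is k.-homog -> f^`M(i) \is k.-1.-homog.
Proof.
move=> fk; apply/dhomogP => m; rewrite mcoeff_msupp mcoeff_mderiv => mf.
have : f@_(m + U_(i)) != 0 by apply: contraNneq mf => ->; rewrite mul0rn.
rewrite -mcoeff_msupp => /(dhomogP _ _ _ fk) /=.
by rewrite mdegD mdeg1 addn1 => <-.
Qed.

End Calculus.

(** * Transversality from the number of intersection points *)

Section Vectors.
Variable K : fieldType.
Implicit Types (a b c p q v w : 'I_3 -> K).

Lemma cross_eq0_proportional p q j : q j != 0 -> (forall i, cross p q i = 0) ->
  exists k, forall i, p i = k * q i.
Proof.
move=> qj pq0; exists (p j / q j) => i; apply: (mulIf qj).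
rewrite mulrAC divfK //.
have e0 : p o1 * q o2 = p o2 * q o1 by apply/eqP; rewrite -subr_eq0 -(pq0 o0).
have e1 : p o2 * q o0 = p o0 * q o2 by apply/eqP; rewrite -subr_eq0 -(pq0 o1).
have e2 : p o0 * q o1 = p o1 * q o0 by apply/eqP; rewrite -subr_eq0 -(pq0 o2).
move: i j {qj}; by elim/forall_ord3; elim/forall_ord3.
Qed.

Lemma det3_cross p q c : det3 p q c = \sum_(i < 3) cross p q i * c i.
Proof. by rewrite sum_ord3 /det3 /cross /=; ring. Qed.

Lemma det3_rot a b c : det3 a b c = det3 b c a.
Proof. by rewrite /det3; ring. Qed.

Lemma det3_scale k a b c p : (forall i, a i = k * p i) -> det3 a b c = k * det3 p b c.
Proof. by move=> ap; rewrite /det3 !ap; ring. Qed.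

Lemma det3_scale2 k a b c p : (forall i, b i = k * p i) -> det3 a b c = k * det3 a p c.
Proof. by move=> bp; rewrite /det3 !bp; ring. Qed.

Lemma det3_diag a c : det3 a a c = 0.
Proof. by rewrite /det3; ring. Qed.

Lemma cramer3 a b c p i : det3 a b c * p i
  = det3 p b c * a i + det3 a p c * b i + det3 a b p * c i.
Proof. by rewrite /det3; elim/forall_ord3: i; ring. Qed.

(** Two points p and q project from c to the same point of the pencil of lines if
    and only if p, q and c are aligned. *)
Lemma plucker3 a b c p q : det3 a p c * det3 q b c - det3 a q c * det3 p b c
  = - (det3 a b c * det3 p q c).
Proof. by rewrite /det3; ring. Qed.

End Vectors.

Section Transversality.
Variable K : closedFieldType.
Local Notation S := {mpoly K[3]}.
Implicit Types (f g : S) (a b c d v w : 'I_3 -> K).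

Definition grad f : 'I_3 -> S := fun i => f^`M(i).
Definition gradient_at f v : 'I_3 -> K := fun i => (f^`M(i)).@[v].

Lemma cross_gradE f g v i :
  (cross (grad f) (grad g) i).@[v] = cross (gradient_at f v) (gradient_at g v) i.
Proof.
rewrite /cross /grad /gradient_at.
by elim/forall_ord3: i; rewrite /= rmorphB !rmorphM.
Qed.

Lemma euler_at n f v : f \is n.-homog ->
  \sum_(i < 3) v i * gradient_at f v i = n%:R * f.@[v].
Proof.
move=> /euler_formula/(congr1 (meval v)).
rewrite rmorph_sum rmorphM rmorph_nat /= => <-.
by apply: eq_bigr => i _; rewrite rmorphM /= mevalXU.
Qed.

Lemma cross_neq0 c m f p j : (0 < m)%N -> f \is m.-homog -> f.@[c] = 1 ->
  f.@[p] = 0 -> p j != 0 -> exists i, cross c p i != 0.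
Proof.
move=> m_gt0 fm fc fp pj.
have [/eqP c0|] := eqVneq (cross c p o0) 0; last by exists o0.
have [/eqP c1|] := eqVneq (cross c p o1) 0; last by exists o1.
have [/eqP c2|] := eqVneq (cross c p o2) 0; last by exists o2.
have [|k ck] := cross_eq0_proportional pj (p := c).
  by apply: forall_ord3; apply/eqP.
by have := oner_neq0 K; rewrite -fc (meval_homog fm ck) fp mulr0 eqxx.
Qed.

(** With multiplicity, r has one root more than its degree allows. *)
Lemma eq0_of_double_root n (r : {poly K}) (t : 'I_n -> K) i0 :
    (size r <= n.+1)%N -> injective t -> (forall i, r.[t i] = 0) ->
    t i0 = 0 -> r^`().[0] = 0 -> r = 0.
Proof.
move=> szr t_inj rt t0 r'0; have [//|r_neq0] := eqVneq r 0.
have [q rE] : exists q, r = q * 'X.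
  have /factor_theorem[q] : root r 0 by rewrite rootE -[X in _.[X]]t0 rt.
  by rewrite subr0; exists q.
have q_neq0 : q != 0 by apply: contraNneq r_neq0 => q0; rewrite rE q0 mul0r.
have q0 : q.[0] = 0.
  by move: r'0; rewrite rE derivM derivX mulr1 !hornerE.
have szq : (size q <= n)%N by move: szr; rewrite rE size_mulX.
have := @max_poly_roots _ q [seq t i | i <- enum 'I_n] q_neq0.
rewrite map_inj_uniq // enum_uniq size_map size_enum_ord => H.
suff : (n < n)%N by rewrite ltnn.
apply: leq_trans (H _ isT) szq; apply/allP => _ /mapP[i _ ->].
have [ti0|ti_neq0] := eqVneq (t i) 0; first by rewrite ti0 rootE q0.
by have /eqP := rt i; rewrite rE hornerMX mulf_eq0 (negPf ti_neq0) orbF.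
Qed.

(** The jets below restrict polynomials in X, Y, Z to a parametrised line through
    the point X = 1, Y = Z = 0, given by Y = y(t) and Z = z(t). *)
Definition jet1 : {rmorphism {poly K} -> {poly K}} := polyC \o horner_eval 1.
Definition jet2 (y : {poly K}) : {rmorphism {poly {poly K}} -> {poly K}} :=
  poly_eval jet1 y.
Definition jet (y z : {poly K}) : {rmorphism {poly {poly {poly K}}} -> {poly K}} :=
  poly_eval (jet2 y) z.

Lemma jet2E y P : jet2 y P = (map_poly jet1 P).[y]. Proof. by []. Qed.

Lemma jetE y z P : jet y z P = (map_poly (jet2 y) P).[z]. Proof. by []. Qed.

Lemma jetC y z P : jet y z P%:P = jet2 y P.
Proof. by rewrite jetE map_polyC hornerC. Qed.

Lemma jetX y z : jet y z 'X = z.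
Proof. by rewrite jetE map_polyX hornerX. Qed.

Lemma jet2C y p : jet2 y p%:P = p.[1]%:P.
Proof. by rewrite jet2E map_polyC hornerC. Qed.

Lemma jet2X y : jet2 y 'X = y.
Proof. by rewrite jet2E map_polyX hornerX. Qed.

Lemma jetD y z P Q : jet y z (P + Q) = jet y z P + jet y z Q.
Proof. exact: rmorphD. Qed.

Lemma jetM y z P Q : jet y z (P * Q) = jet y z P * jet y z Q.
Proof. exact: rmorphM. Qed.

Lemma jet_frame a b c d y z f : (forall i, (b i)%:P * y + (c i)%:P * z = (d i)%:P * 'X) ->
  jet y z (frame_subst a b c f) = along a d f.
Proof.
move=> yz; have := @mpoly_rmorph_ext _ _ _ (jet y z \o frame_subst a b c) (along a d).
have jet_const k : jet y z (const3 k) = k%:P by rewrite /const3 /= jetC jet2C hornerC.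
apply=> [k|i]; rewrite /=; first by rewrite frame_substC alongC jet_const.
rewrite frame_substX alongX -yz addrA.
rewrite !jetD !jetM !jet_const.
by rewrite jetX !jetC jet2X jet2C hornerX mulr1.
Qed.

Lemma jet2_at0 y P : (jet2 y P).[0] = eval2 1 y.[0] P.
Proof.
rewrite jet2E eval2E -[LHS]/(horner_eval 0 _) -horner_map.
congr (_.[_]); rewrite -(map_poly_comp (horner_eval 0) jet1).
by apply: eq_map_poly => p /=; rewrite /horner_eval hornerC.
Qed.

Lemma jet_at0 y z P : (jet y z P).[0] = eval3 1 y.[0] z.[0] P.
Proof.
rewrite jetE eval3E -[LHS]/(horner_eval 0 _) -horner_map.
congr (_.[_]); rewrite -(map_poly_comp (horner_eval 0) (jet2 y)).
by apply: eq_map_poly => p; rewrite -jet2_at0.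
Qed.

(** An element of the ideal (f, g), differentiated at a common zero of f and g:
    only the derivatives of f and g contribute. *)
Lemma jet_combination f g a b c d y z u1 u2 (R : {poly {poly K}}) :
    R%:P = u1 * frame_subst a b c g + u2 * frame_subst a b c f ->
    (forall i, (b i)%:P * y + (c i)%:P * z = (d i)%:P * 'X) ->
    y.[0] = 0 -> z.[0] = 0 -> f.@[a] = 0 -> g.@[a] = 0 ->
  (jet2 y R)^`().[0] = eval3 1 0 0 u1 * \sum_(i < 3) d i * gradient_at g a i
                     + eval3 1 0 0 u2 * \sum_(i < 3) d i * gradient_at f a i.
Proof.
move=> RE yz y0 z0 fa ga; rewrite -(jetC y z) RE jetD !jetM (jet_frame a f yz) (jet_frame a g yz).
rewrite derivD hornerD !derivM !hornerD !hornerM !along_at0 fa ga !mulr0 !add0r.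
by rewrite !along_deriv !jet_at0 y0 z0.
Qed.

(** The points ps represent all the common zeros of f1 and f2, without repetition;
    the hypothesis that they are n1 n2 in number is in the type of their index. *)
Variables (n1 n2 : nat) (f1 f2 : S) (ps : 'I_(n1 * n2) -> 'I_3 -> K).
Hypothesis K_char0 : forall n, (n%:R == 0 :> K) = (n == 0%N).
Hypotheses (n1_gt0 : (0 < n1)%N) (n2_gt0 : (0 < n2)%N).
Hypotheses (f1n : f1 \is n1.-homog) (f2n : f2 \is n2.-homog).
Hypothesis (f2_neq0 : f2 != 0).
Hypothesis ps_zero : forall i, f1.@[ps i] = 0 /\ f2.@[ps i] = 0.
Hypothesis ps_neq0 : forall i, exists j, ps i j != 0.
Hypothesis ps_uniq : forall i j, i != j -> exists k, cross (ps i) (ps j) k != 0.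
Hypothesis ps_all : forall w j, w j != 0 -> f1.@[w] = 0 -> f2.@[w] = 0 ->
  exists i k, forall l, w l = k * ps i l.

(** Only finitely many lines through c meet the finite set of common zeros. *)
Lemma exists_free_line a b c : det3 a b c != 0 ->
  exists t, forall z, f2.@[frame_point a b c 1 t z] = 0 ->
    f1.@[frame_point a b c 1 t z] <> 0.
Proof.
move=> D_neq0; pose t i := det3 a (ps i) c / det3 (ps i) b c.
have [|s sP] := @exists_nonroot K (\prod_(i < n1 * n2) ('X - (t i)%:P)).
  by rewrite prodf_seq_neq0; apply/allP => i _; rewrite polyXsubC_eq0.
exists s => z; set w := frame_point _ _ _ _ _ _ => f2w f1w.
have [Dx Dy _] := frame_coordE a b c 1 s z.
rewrite -/w mul1r in Dx Dy.
have [j wj] : exists j, w j != 0.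
  by have [] // := @det3_neq0 _ w b c; rewrite Dx.
have [i [k wk]] := ps_all wj f1w f2w.
have k_neq0 : k != 0 by apply: contraNneq wj => k0; rewrite wk k0 mul0r.
case/negP: sP; rewrite horner_prod (bigD1 i) //= mulf_eq0; apply/orP; left.
rewrite !hornerE subr_eq0; apply/eqP.
move: Dx Dy; rewrite (det3_scale b c wk) (det3_scale2 a c wk) => Dx Dy.
have Dp : det3 (ps i) b c != 0 by apply: contraNneq D_neq0 => D0; rewrite -Dx D0 mulr0.
apply: (mulIf Dp); rewrite /t divfK //; apply: (mulfI k_neq0).
by rewrite mulrCA Dx Dy.
Qed.

(** A line through a point off C2 that misses the common zeros makes the eliminant
    of f1 and f2 nonzero. *)
Lemma free_line_cancel h : divides f2 (f1 * h) -> divides f2 h.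
Proof.
have [c [f2c _]] := @exists_normalized_point K n2 f2 [::] n2_gt0 f2n f2_neq0 isT.
have [i0 ci0] := normalized_nonzero n2_gt0 f2n f2c.
have [a [b D_neq0]] := frame_exists ci0.
have [t free] := exists_free_line D_neq0.
exact: divides_cancel n2_gt0 f2n f2c f1n D_neq0 free.
Qed.

(** Suppose that the gradients are proportional at v.  In a frame that starts at v
    and ends at a general c, the eliminant r(t) of f1 and f2 on X = 1 has degree at
    most n1 n2 and vanishes at the n1 n2 distinct slopes of the lines from c to the
    common zeros, one of which is t = 0.  Write r = u1 f2 + u2 f1.  As r does not
    depend on Z and the tangent line of f2 at v does not pass through c,
    differentiation in Z gives u1 + k u2 = 0 at v, where k is the ratio of the
    gradients; differentiation in Y then gives r'(0) = 0, one root too many. *)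
Lemma transversal v j : v j != 0 -> f2.@[v] = 0 ->
    (exists i, gradient_at f2 v i != 0) ->
  exists i, (cross (grad f1) (grad f2) i).@[v] != 0.
Proof.
move=> vj f2v [i1 g2v].
suff : ~ (forall i, (cross (grad f1) (grad f2) i).@[v] = 0).
  move=> nz; have [/existsP//|/existsPn no_i] :=
    boolP [exists i, (cross (grad f1) (grad f2) i).@[v] != 0].
  by case: nz => i; apply/eqP; have := no_i i; rewrite negbK.
move=> W0; have [|k gE] := cross_eq0_proportional g2v (p := gradient_at f1 v).
  by move=> i; rewrite -cross_gradE W0.
have f1v : f1.@[v] = 0.
  have /eqP : n1%:R * f1.@[v] = 0.
    rewrite -(euler_at v f1n) (eq_bigr (fun i => k * (v i * gradient_at f2 v i))).
      by rewrite -mulr_sumr (euler_at v f2n) f2v !mulr0.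
    by move=> i _; rewrite gE mulrCA.
  by rewrite mulf_eq0 K_char0 eqn0Ngt n1_gt0 => /eqP.
have [i0 [l vE]] := ps_all vj f1v f2v.
pose pairs := [seq ij <- enum (setT : {set 'I_(n1 * n2) * 'I_(n1 * n2)}) | ij.1 != ij.2].
(* The centre c lies off C2, off the tangent line of C2 at v, and off the lines
   that join two of the points. *)
have [|c [f2c]] := @exists_normalized_point K n2 f2
   (gradient_at f2 v :: [seq cross (ps ij.1) (ps ij.2) | ij <- pairs]) n2_gt0 f2n f2_neq0.
  rewrite /= (lin_form_neq0 g2v) all_map; apply/allP => ij.
  by rewrite mem_filter => /andP[/ps_uniq[m /lin_form_neq0]].
rewrite /= lin_formE all_map => /andP[c_g2 /allP c_ps].
(* The line through b and c, which is X = 0, contains none of the points. *)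
have [|b] := @exists_generic_point K
  (lin_form (cross c v) :: [seq lin_form (cross c (ps i)) | i <- enum 'I_(n1 * n2)]).
  rewrite /= all_map; apply/andP; split.
    by have [m /lin_form_neq0] := cross_neq0 n2_gt0 f2n f2c f2v vj.
  apply/allP => i _ /=; have [_ f2p] := ps_zero i; have [m pm] := ps_neq0 i.
  by have [m' /lin_form_neq0] := cross_neq0 n2_gt0 f2n f2c f2p pm.
rewrite /= all_map => /andP[Dv /allP Dp].
have D_neq0 : det3 v b c != 0 by rewrite -det3_rot det3_cross -lin_formE.
have {}Dp i : det3 (ps i) b c != 0.
  by rewrite -det3_rot det3_cross -lin_formE; apply: Dp; rewrite mem_enum.
have [R [u1 [u2 [RN RE Rroot]]]] := frame_elimination v b n2_gt0 f2n f2c f1n.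
pose r := map_poly (horner_eval 1) R.
pose t i := det3 v (ps i) c / det3 (ps i) b c.
have r_neq0 : r <> 0.
  move=> r0; have [t0 free] := exists_free_line D_neq0.
  have [|z [f2z f1z]] := Rroot 1 t0; first by rewrite eval2E -/r r0 horner0.
  exact: free f2z f1z.
apply: r_neq0; apply: (@eq0_of_double_root _ r t i0).
- by rewrite mulnC (leq_trans (size_poly _ _)) // (poly_grading_size RN).
- move=> i i' tE; apply/eqP; apply: contraT => ne_i.
  have /c_ps : (i, i') \in pairs by rewrite mem_filter ne_i mem_enum inE.
  rewrite /= lin_formE -det3_cross => /negP[].
  have /eqP : det3 v (ps i) c * det3 (ps i') b c - det3 v (ps i') c * det3 (ps i) b c = 0.
    by move/eqP: tE; rewrite eqr_div // => /eqP->; rewrite subrr.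
  by rewrite plucker3 oppr_eq0 mulf_eq0 (negPf D_neq0).
- move=> i; rewrite -[LHS]/(eval2 1 (t i) R).
  pose z := det3 v b (ps i) / det3 (ps i) b c.
  have ptE m : frame_point v b c 1 (t i) z m = (det3 v b c / det3 (ps i) b c) * ps i m.
    have := cramer3 v b c (ps i) m; rewrite /frame_point /t /z.
    move: (det3 v b c) (det3 (ps i) b c) (Dp i) (det3 v (ps i) c) (det3 v b (ps i)).
    move=> D E E_neq0 A B DE; apply: (mulIf E_neq0).
    rewrite [RHS]mulrAC divfK // DE mul1r !mulrDl; congr (_ + _ + _).
    - exact: mulrC.
    - by rewrite mulrAC divfK.
    - by rewrite mulrAC divfK.
  rewrite -(eval3C _ _ z) RE rmorphD !rmorphM /= !frame_substE.
  have [f1p f2p] := ps_zero i.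
  by rewrite (meval_homog f2n ptE) (meval_homog f1n ptE) f1p f2p !mulr0 addr0.
- rewrite /t.
  have -> : det3 v (ps i0) c = 0; last by rewrite mul0r.
  have l_neq0 : l != 0 by apply: contraNneq vj => l0; rewrite vE l0 mul0r.
  by apply: (mulfI l_neq0); rewrite mulr0 -(det3_scale2 v c vE) det3_diag.
have gb : \sum_(i < 3) b i * gradient_at f1 v i = k * \sum_(i < 3) b i * gradient_at f2 v i.
  by rewrite mulr_sumr; apply: eq_bigr => i _; rewrite gE mulrCA.
have gc : \sum_(i < 3) c i * gradient_at f1 v i = k * \sum_(i < 3) c i * gradient_at f2 v i.
  by rewrite mulr_sumr; apply: eq_bigr => i _; rewrite gE mulrCA.
have := @jet_combination f1 f2 v b c c 0 'X u1 u2 R RE _ (hornerC 0 0) (hornerX 0) f1v f2v.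
rewrite gc mulrA -mulrDl => H.
have {H} /eqP : (eval3 1 0 0 u1 + eval3 1 0 0 u2 * k) * (\sum_(i < 3) c i * gradient_at f2 v i) = 0.
  rewrite -H => [|i]; last by rewrite mulr0 add0r.
  by rewrite jet2E (horner_coef0 (map_poly _ _)) coef_map /= derivC horner0.
rewrite mulf_eq0 => /orP[/eqP uk0|]; last first.
  under eq_bigr => i _ do rewrite mulrC.
  by rewrite (negPf c_g2).
have := @jet_combination f1 f2 v b c b 'X 0 u1 u2 R RE _ (hornerX 0) (hornerC 0 0) f1v f2v.
rewrite gb mulrA -mulrDl uk0 mul0r => H; rewrite -[RHS]H => [|i]; last by rewrite mulr0 addr0.
suff -> : jet2 'X R = r by [].
rewrite jet2E -[RHS]comp_polyXr /comp_poly /r -(map_poly_comp polyC (horner_eval 1)).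
by congr (_.[_]); apply: eq_map_poly.
Qed.

End Transversality.

(** * The two smallest degrees of a module of syzygies *)

Lemma redundant_combination (A : nzRingType) (V : lmodType A) m (r : 'I_m -> V)
    j j' (s : A) (c : 'I_m -> A) : j != j' -> r j = s *: r j' ->
  \sum_(l in [set: 'I_m]) c l *: r l = \sum_(l in [set: 'I_m] :\ j)
    (c l + (if l == j' then c j * s else 0)) *: r l.
Proof.
move=> ne_jj' rj; rewrite (bigD1 j) ?inE //= rj scalerA.
transitivity ((c j * s) *: r j' + \sum_(i in [set: 'I_m] :\ j) c i *: r i).
  by congr (_ + _); apply: eq_bigl => l; rewrite !inE andbT.
under [RHS]eq_bigr => l _ do rewrite scalerDl.
rewrite big_split /= addrC; congr (_ + _).
rewrite (bigD1 j') ?inE 1?eq_sym ?ne_jj' //= eqxx big1 ?addr0 // => l /andP[_ /negPf->].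
by rewrite scale0r.
Qed.

Section FirstDegrees.
Variable K : closedFieldType.
Local Notation S := {mpoly K[3]}.
Implicit Types (f g s : S) (a b r : 'rV[S]_3).

Definition deriv_along a f : S := \sum_(i < 3) a 0 i * f^`M(i).
Definition homog_row k a := forall i, a 0 i \is k.-homog.

Lemma homog_row_scale k d s a r : homog_row k a -> homog_row d r -> a = s *: r ->
  (d <= k)%N /\ (exists2 s', s' \is (k - d).-homog & a = s' *: r) \/ a = 0.
Proof.
move=> ka dr aE.
have aiE i : a 0 i = if (d <= k)%N then pihomog mdeg (k - d) s * r 0 i else 0.
  by rewrite -(pihomogM _ _ (dr i)) -[LHS](pihomog_dE (ka i)) aE mxE.
case: leqP aiE => [le_dk|_] aiE; [left; split=> //|right].
  exists (pihomog mdeg (k - d) s); first exact: pihomogP.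
  by apply/rowP => i; rewrite mxE aiE.
by apply/rowP => i; rewrite mxE aiE.
Qed.

(** Only generators of degree at most k can contribute in degree k. *)
Lemma homog_row_combination m (J : {set 'I_m}) (r : 'I_m -> 'rV[S]_3) (d : 'I_m -> nat)
    (c : 'I_m -> S) k : (forall j, homog_row (d j) (r j)) ->
    homog_row k (\sum_(j in J) c j *: r j) ->
  exists c' : 'I_m -> S, \sum_(j in J) c j *: r j
    = \sum_(j in J) (if (d j <= k)%N then c' j else 0) *: r j.
Proof.
move=> rd ka; exists (fun j => pihomog mdeg (k - d j) (c j)).
apply/rowP => i; rewrite -[LHS](pihomog_dE (ka i)) !summxE raddf_sum /=.
apply: eq_bigr => l _; rewrite !mxE (pihomogM _ _ (rd l i)).
by case: ifP; rewrite ?mul0r.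
Qed.

(** A description of d1 and d2 without generators: D_0(f) is zero below degree d1,
    it contains a nonzero r1 of degree d1, all its elements of degree less than d2
    are multiples of r1, and some element of degree d2 is not. *)
Definition first_degrees f d1 d2 := (d1 <= d2)%N /\ exists r1 r2,
  [/\ [/\ r1 != 0, deriv_along r1 f = 0 & homog_row d1 r1],
      [/\ forall s, r2 <> s *: r1, deriv_along r2 f = 0 & homog_row d2 r2],
      forall k a, deriv_along a f = 0 -> homog_row k a -> (k < d1)%N -> a = 0 &
      forall k a, deriv_along a f = 0 -> homog_row k a -> (k < d2)%N ->
        exists s, a = s *: r1].

(** If e2 < d2, the rows q1 and q2 that witness e1 and e2 are multiples of r1.
    The row q1 has the same degree as r1, so it is a nonzero constant multiple of
    r1, and q2 is a multiple of q1. *)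
Lemma first_degrees_le f d1 d2 e1 e2 :
  first_degrees f d1 d2 -> first_degrees f e1 e2 -> (d1 <= e1)%N /\ (d2 <= e2)%N.
Proof.
move=> [d12 [r1 [r2 [[r1_neq0 r1f r1d] [r2_ind r2f r2d] small1 small2]]]].
move=> [e12 [q1 [q2 [[q1_neq0 q1f q1e] [q2_ind q2f q2e] small1' small2']]]].
have le1 : (d1 <= e1)%N.
  by rewrite leqNgt; apply/negP => /(small1 _ _ q1f q1e)/eqP; rewrite (negPf q1_neq0).
split=> //; rewrite leqNgt; apply/negP => lt_ed.
have [s1 q1E] := small2 _ _ q1f q1e (leq_ltn_trans e12 lt_ed).
have [s2 q2E] := small2 _ _ q2f q2e lt_ed.
have le1' : (e1 <= d1)%N.
  by rewrite leqNgt; apply/negP => /(small1' _ _ r1f r1d)/eqP; rewrite (negPf r1_neq0).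
have [[_ [c c0 q1cE]]|q10] := homog_row_scale q1e r1d q1E; last by case/eqP: q1_neq0.
have e1d1 : e1 = d1 by apply/eqP; rewrite eqn_leq le1 le1'.
move: c0; rewrite e1d1 subnn => c0.
have [k ck] : exists k, c = k%:MP.
  exists c@_0%MM; apply/mpolyP => m; rewrite mcoeffC.
  have [->|m_neq0] := eqVneq m 0%MM; first by rewrite mulr1.
  rewrite mulr0; apply: (dhomog_nemf_coeff c0).
  by rewrite /= mdeg_eq0.
have k_neq0 : k != 0.
  by apply: contraNneq q1_neq0 => k0; rewrite q1cE ck k0 mpolyC0 scale0r.
apply: (q2_ind (s2 * k^-1%:MP)); rewrite q1cE scalerA -mulrA ck -mpolyCM.
by rewrite mulVf // mpolyC1 mulr1.
Qed.

Lemma first_degrees_uniq f d1 d2 e1 e2 :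
  first_degrees f d1 d2 -> first_degrees f e1 e2 -> d1 = e1 /\ d2 = e2.
Proof.
move=> fd fe; have [le1 le2] := first_degrees_le fd fe.
have [ge1 ge2] := first_degrees_le fe fd.
by split; apply/eqP; rewrite eqn_leq ?le1 ?le2.
Qed.

Definition generators f m (r : 'I_m -> 'rV[S]_3) (J : {set 'I_m}) :=
  forall a, deriv_along a f = 0 ->
    exists c : 'I_m -> S, a = \sum_(j in J) c j *: r j.

Lemma redundant_generator f m (r : 'I_m -> 'rV[S]_3) j j' s :
    generators f r [set: 'I_m] -> j != j' -> r j = s *: r j' ->
  generators f r ([set: 'I_m] :\ j).
Proof.
move=> gen ne_jj' rj a /gen[c ->].
by eexists; apply: redundant_combination ne_jj' rj.
Qed.

(** By minimality the first generator is nonzero and the second one is not a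
    multiple of the first; all generators but the first have degree at least d2. *)
Lemma minimal_generators_first_degrees f d1 d2 ds (m := size [:: d1, d2 & ds])
    (r : 'I_m -> 'rV[S]_3) : sorted leq [:: d1, d2 & ds] ->
    (forall j : 'I_m, deriv_along (r j) f = 0) ->
    (forall j : 'I_m, homog_row (nth 0%N [:: d1, d2 & ds] j) (r j)) ->
    generators f r [set: 'I_m] ->
    (forall J : {set 'I_m}, J \proper [set: 'I_m] -> ~ generators f r J) ->
  first_degrees f d1 d2.
Proof.
move=> sorted_ds r_syz r_homog r_gen r_min.
pose j0 : 'I_m := ord0; pose j1 : 'I_m := lift ord0 ord0.
have /andP[le_d12 path_ds] : (d1 <= d2)%N && path leq d2 ds by [].
have ge_d2 (j : 'I_m) : j != j0 -> (d2 <= nth 0 [:: d1, d2 & ds] j)%N.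
  case: j => [[|[|j]] lt_j] //= _.
  by have /(all_nthP 0%N) := order_path_min leq_trans path_ds; apply.
have proper_D1 j : [set: 'I_m] :\ j \proper [set: 'I_m] by rewrite properD1 ?inE.
have homog_part k a : deriv_along a f = 0 -> homog_row k a -> exists c : 'I_m -> S,
    a = \sum_(j < m) (if (nth 0 [:: d1, d2 & ds] j <= k)%N then c j else 0) *: r j.
  move=> /r_gen[c ->] /(homog_row_combination r_homog)[c' ->].
  by exists c'; apply: eq_bigl => j; rewrite inE.
split=> //; exists (r j0), (r j1); split.
- split; [|exact: r_syz|exact: r_homog].
  apply/eqP => r0; apply: (r_min _ (proper_D1 j0)).
  by apply: (@redundant_generator f m r j0 j1 0) => //; rewrite scale0r.
- split; [|exact: r_syz|exact: r_homog].
  move=> s rE; apply: (r_min _ (proper_D1 j1)).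
  exact: (@redundant_generator f m r j1 j0 s).
- move=> k a af ka lt_k; have [c ->] := homog_part k a af ka.
  rewrite big1 // => j _; rewrite ifF ?scale0r //.
  have [->|/ge_d2] := eqVneq j j0; first by rewrite leqNgt lt_k.
  by move=> le_j; rewrite leqNgt (leq_trans lt_k) // (leq_trans le_d12).
move=> k a af ka lt_k; have [c ->] := homog_part k a af ka.
exists (if (d1 <= k)%N then c j0 else 0).
rewrite (bigD1 j0) //= big1 ?addr0 // => j /ge_d2 le_j.
by rewrite ifF ?scale0r // leqNgt (leq_trans lt_k).
Qed.

End FirstDegrees.

(** * Syzygies of a union of two curves *)

Section Union.
Variable K : closedFieldType.
Local Notation S := {mpoly K[3]}.
Implicit Types (f g s : S) (a b r : 'rV[S]_3).
Variables (n1 n2 : nat) (f1 f2 : S).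
Hypothesis K_char0 : forall n, (n%:R == 0 :> K) = (n == 0%N).
Hypotheses (n1_gt0 : (0 < n1)%N) (n2_gt0 : (0 < n2)%N).
Hypotheses (f1n : f1 \is n1.-homog) (f2n : f2 \is n2.-homog).
Hypotheses (f1_neq0 : f1 != 0) (f2_neq0 : f2 != 0).
Hypothesis f2_coprime : forall h, divides f2 (f1 * h) -> divides f2 h.
Hypothesis transversality : forall v i, v i != 0 -> f2.@[v] = 0 ->
  exists j, (cross (grad f1) (grad f2) j).@[v] != 0.

(** The Euler derivation. *)
Definition radial : 'rV[S]_3 := \row_i 'X_i.

Lemma deriv_alongB a b f : deriv_along (a - b) f = deriv_along a f - deriv_along b f.
Proof. by rewrite -sumrB; apply: eq_bigr => i _; rewrite !mxE mulrBl. Qed.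

Lemma deriv_alongZ s a f : deriv_along (s *: a) f = s * deriv_along a f.
Proof. by rewrite mulr_sumr; apply: eq_bigr => i _; rewrite mxE mulrA. Qed.

Lemma deriv_alongM a f g :
  deriv_along a (f * g) = deriv_along a f * g + f * deriv_along a g.
Proof.
rewrite mulr_suml mulr_sumr -big_split; apply: eq_bigr => i _.
by rewrite mderivM /=; ring.
Qed.

Lemma deriv_radial n f : f \is n.-homog -> deriv_along radial f = n%:R * f.
Proof.
by move=> /euler_formula <-; apply: eq_bigr => i _; rewrite mxE.
Qed.

Lemma deriv_homog k n a f : homog_row k a -> f \is n.-homog ->
  deriv_along a f \is (k + n.-1).-homog.
Proof. by move=> ka fn; apply: rpred_sum => i _; apply: dhomogM => //; apply: mderiv_homog. Qed.

Let inv_deg : S := ((n1 + n2)%:R^-1 : K)%:MP.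

Lemma inv_degK : inv_deg * (n1 + n2)%:R = 1.
Proof.
rewrite -[(n1 + n2)%:R]mpolyC_nat /inv_deg -mpolyCM mulVf ?mpolyC1 //.
by rewrite K_char0 addn_eq0 negb_and -!lt0n n1_gt0.
Qed.

(** The multiple of the Euler derivation is the one that makes the derivation kill
    the product f1 f2, given that a kills f1. *)
Definition lift_syzygy a := f2 *: a - (inv_deg * deriv_along a f2) *: radial.

Lemma lift_syzygyP a : deriv_along a f1 = 0 -> deriv_along (lift_syzygy a) (f1 * f2) = 0.
Proof.
move=> a1; rewrite /lift_syzygy deriv_alongM !deriv_alongB !deriv_alongZ.
rewrite !(deriv_radial f1n, deriv_radial f2n) a1.
set A := deriv_along a f2.
have -> : (f2 * 0 - inv_deg * A * (n1%:R * f1)) * f2 + f1 * (f2 * A - inv_deg * A * (n2%:R * f2))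
  = (1 - inv_deg * (n1%:R + n2%:R)) * (A * f1 * f2) by ring.
by rewrite -natrD inv_degK subrr mul0r.
Qed.

Lemma lift_syzygyZ s a : lift_syzygy (s *: a) = s *: lift_syzygy a.
Proof.
by rewrite /lift_syzygy deriv_alongZ scalerBr !scalerA mulrCA [f2 * s]mulrC.
Qed.

Lemma lift_syzygy0 : lift_syzygy 0 = 0.
Proof. by rewrite -(scale0r (0 : 'rV[S]_3)) lift_syzygyZ !scale0r. Qed.

Lemma lift_syzygyB a b : lift_syzygy (a - b) = lift_syzygy a - lift_syzygy b.
Proof.
by apply/rowP => i; rewrite !mxE deriv_alongB; ring.
Qed.

(** If f2 a = s E with a(f1) = 0, then 0 = s n1 f1, so s = 0 and a = 0. *)
Lemma lift_syzygy_eq0 a : deriv_along a f1 = 0 -> lift_syzygy a = 0 -> a = 0.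
Proof.
move=> a1 /eqP; rewrite subr_eq0 => /eqP E.
have := congr1 (fun r => deriv_along r f1) E.
rewrite !deriv_alongZ (deriv_radial f1n) a1 mulr0 => /esym/eqP.
have n1_neq0 : (n1%:R : S) != 0.
  by rewrite -mpolyC_nat mpolyC_eq0 K_char0 -lt0n.
rewrite mulf_eq0 [n1%:R * _ == 0]mulf_eq0 (negPf n1_neq0) (negPf f1_neq0) !orbF => /eqP A0.
rewrite A0 scale0r in E; apply/rowP => i; have := congr1 (fun r : 'rV_3 => r 0 i) E.
by rewrite !mxE => /eqP; rewrite mulf_eq0 (negPf f2_neq0) => /eqP.
Qed.

Lemma lift_syzygy_homog k a : homog_row k a -> homog_row (k + n2) (lift_syzygy a).
Proof.
move=> ka i; rewrite !mxE.
apply: rpredB; first by rewrite addnC; apply: dhomogM.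
have -> : (k + n2 = 0 + (k + n2.-1) + 1)%N by lia.
apply: dhomogM; last by rewrite dhomogX /= mdeg1.
apply: dhomogM; last exact: deriv_homog.
by rewrite /inv_deg -[_%:MP]mulr1 mul_mpolyC; apply: dhomogZ; apply: dhomog1.
Qed.

(** Needed because divisibility by f2 says nothing of the degree of the quotient. *)
Lemma quotient_homog e s : s * f2 \is e.-homog ->
  (n2 <= e)%N /\ s \is (e - n2).-homog \/ s = 0.
Proof.
move=> sf2; have := pihomogM e s f2n; rewrite (pihomog_dE sf2).
case: leqP => [le_ne|_] /eqP sE; [left|right].
  split=> //; move: sE; rewrite (inj_eq (mulIf f2_neq0)) => /eqP->.
  exact: pihomogP.
by move: sE; rewrite mulf_eq0 (negPf f2_neq0) orbF => /eqP.
Qed.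

Lemma cross_cross (u v w : 'I_3 -> S) i : cross u (cross v w) i
  = v i * (\sum_(j < 3) u j * w j) - w i * (\sum_(j < 3) u j * v j).
Proof. by rewrite !sum_ord3 /cross; elim/forall_ord3: i => /=; ring. Qed.

(** By the double cross product formula, d x (A x B) = A (d.B) - B (d.A). *)
Lemma tangent_proportional (d : 'rV[S]_3) (g : S) :
    deriv_along d f1 = 0 -> deriv_along d f2 = g * f2 ->
  forall i j, divides f2 (d 0 i * cross (grad f1) (grad f2) j
                        - d 0 j * cross (grad f1) (grad f2) i).
Proof.
move=> d1 d2; set W := cross _ _.
have dW i : divides f2 (cross (d 0) W i).
  exists (grad f1 i * g); rewrite cross_cross [X in _ - _ * X]d1 mulr0 subr0.
  by rewrite [X in _ * X]d2 mulrA.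
have dWN i : divides f2 (- cross (d 0) W i).
  by have [s ->] := dW i; exists (- s); rewrite mulNr.
have dW0 x : divides f2 (x - x) by exists 0; rewrite subrr mul0r.
elim/forall_ord3; elim/forall_ord3 => //.
- by have := dW o2.
- by have := dWN o1; rewrite opprB.
- by have := dWN o2; rewrite opprB.
- by have := dW o0.
- by have := dW o1.
- by have := dWN o0; rewrite opprB.
Qed.

(** With b(f2) = g f2 and b(f1) = - g f1, the row d = b + (g / n1) E kills f1 and
    maps f2 to a multiple of itself.  It is proportional to the cross product of
    the gradients along f2 = 0, and its degree is smaller, so f2 divides it. *)
Lemma lift_syzygy_onto k b : deriv_along b (f1 * f2) = 0 -> homog_row k b ->
    (k < n1.-1 + n2.-1)%N ->
  exists a, [/\ deriv_along a f1 = 0, b = lift_syzygy a &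
    (n2 <= k)%N /\ homog_row (k - n2) a \/ a = 0].
Proof.
rewrite deriv_alongM => bf bk lt_k.
have [g gE] : divides f2 (deriv_along b f2).
  apply: f2_coprime; exists (- deriv_along b f1).
  by apply/eqP; rewrite -subr_eq0 mulNr opprK addrC bf.
have b1E : deriv_along b f1 = - (g * f1).
  apply: (mulIf f2_neq0); apply/eqP; rewrite -subr_eq0 -bf gE; apply/eqP; ring.
pose c : S := (n1%:R^-1 : K)%:MP.
have cK : c * n1%:R = 1.
  by rewrite -[n1%:R]mpolyC_nat /c -mpolyCM mulVf ?mpolyC1 // K_char0 -lt0n.
have c_homog : c \is 0.-homog.
  by rewrite /c -[_%:MP]mulr1 mul_mpolyC; apply: dhomogZ; apply: dhomog1.
(* The constant c is 1 / n1; the double sign gives d the shape of a difference. *)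
pose d : 'rV[S]_3 := b - (- (c * g)) *: radial.
have d1 : deriv_along d f1 = 0.
  rewrite deriv_alongB deriv_alongZ (deriv_radial f1n) b1E.
  have -> : - (g * f1) - - (c * g) * (n1%:R * f1) = (c * n1%:R - 1) * (g * f1) by ring.
  by rewrite cK subrr mul0r.
have d2 : deriv_along d f2 = (g + c * g * n2%:R) * f2.
  by rewrite deriv_alongB deriv_alongZ (deriv_radial f2n) gE; ring.
have dk i : d 0 i \is k.-homog.
  rewrite !mxE; apply: rpredB; first exact: bk.
  have [|[le_k gk]|->] := @quotient_homog (k + n2.-1) g.
  - by rewrite -gE; apply: deriv_homog.
  - have -> : (k = 0 + (k + n2.-1 - n2) + 1)%N by lia.
    apply: dhomogM; last by rewrite dhomogX /= mdeg1.
    by rewrite -mulrN; apply: dhomogM => //; rewrite rpredN.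
  by rewrite mulr0 oppr0 mul0r rpred0.
have Wn i : cross (grad f1) (grad f2) i \is (n1.-1 + n2.-1).-homog.
  have g1 l : grad f1 l \is n1.-1.-homog by apply: mderiv_homog.
  have g2 l : grad f2 l \is n2.-1.-homog by apply: mderiv_homog.
  by rewrite /cross; do 2?case: ifP => _; apply: rpredB; apply: dhomogM.
have /fin_all_exists[a aE] := divides_of_proportional n2_gt0 f2n f2_neq0 Wn dk lt_k
  transversality (tangent_proportional d1 d2).
pose a' : 'rV[S]_3 := \row_i a i.
have dE : d = f2 *: a' by apply/rowP => i; rewrite aE !mxE mulrC.
have a'1 : deriv_along a' f1 = 0.
  apply/eqP; have /eqP := d1; rewrite dE deriv_alongZ mulf_eq0.
  by rewrite (negPf f2_neq0).
have a'2 : deriv_along a' f2 = g + c * g * n2%:R.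
  by apply: (mulfI f2_neq0); rewrite -deriv_alongZ -dE d2 mulrC.
exists a'; split=> //.
  rewrite /lift_syzygy -dE a'2; have -> : inv_deg * (g + c * g * n2%:R) = c * g.
    have -> : g + c * g * n2%:R = c * g * (n1 + n2)%:R.
      by rewrite natrD mulrDr; congr (_ + _); rewrite mulrAC cK mul1r.
    by rewrite mulrCA [inv_deg * _]inv_degK mulr1.
  by rewrite /d scaleNr opprK addrK.
have [le_nk|lt_kn] := leqP n2 k; [left; split=> // i|right; apply/rowP => i].
  rewrite mxE; have [|[_ //]|->] := @quotient_homog k (a i); last exact: rpred0.
  by rewrite -aE.
have [|[]|ai0] := @quotient_homog k (a i); [by rewrite -aE|by rewrite leqNgt lt_kn|].
by rewrite !mxE ai0.
Qed.

(** The lifts of r1 and r2 are the witnesses.  A syzygy of f1 f2 of degree less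
    than d2 + n2 has degree less than n1 + n2 - 2, so it is itself a lift, and the
    minimality of d1 and d2 for f1 applies to the row that it comes from. *)
Theorem first_degrees_union d1 d2 : (d2 + 2 <= n1)%N ->
  first_degrees f1 d1 d2 -> first_degrees (f1 * f2) (d1 + n2) (d2 + n2).
Proof.
move=> le_d2 [d12 [r1 [r2 [[r1_neq0 r1f r1d] [r2_ind r2f r2d] small1 small2]]]].
have lifted k b : deriv_along b (f1 * f2) = 0 -> homog_row k b -> (k < d2 + n2)%N ->
    b = 0 \/ exists a, [/\ deriv_along a f1 = 0, b = lift_syzygy a, homog_row (k - n2) a & (n2 <= k)%N].
  move=> bf bk lt_k; have [|a [af bE]] := lift_syzygy_onto bf bk; first by lia.
  case=> [[le_k ak]|a0]; first by right; exists a.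
  by left; rewrite bE a0 lift_syzygy0.
split; first by rewrite leq_add2r.
exists (lift_syzygy r1), (lift_syzygy r2); split.
- split; [|exact: lift_syzygyP|exact: lift_syzygy_homog].
  by apply: contraNneq r1_neq0 => /(lift_syzygy_eq0 r1f)->.
- split; [|exact: lift_syzygyP|exact: lift_syzygy_homog].
  move=> s E; apply: (r2_ind s); apply/eqP; rewrite -subr_eq0; apply/eqP.
  apply: lift_syzygy_eq0; last by rewrite lift_syzygyB lift_syzygyZ E subrr.
  by rewrite deriv_alongB deriv_alongZ r1f r2f mulr0 subr0.
- move=> k b bf bk lt_k; have [|//|[a [af -> ak le_k]]] := lifted k b bf bk.
    by apply: leq_trans lt_k _; rewrite leq_add2r.
  rewrite (small1 _ _ af ak) ?ltn_subLR // 1?addnC //.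
  exact: lift_syzygy0.
move=> k b bf bk lt_k; have [->|[a [af -> ak le_k]]] := lifted k b bf bk lt_k.
  by exists 0; rewrite scale0r.
have [|s ->] := small2 _ _ af ak; first by rewrite ltn_subLR // addnC.
by exists s; rewrite lift_syzygyZ.
Qed.

End Union.

(** * Points of the projective plane and the type of the union *)

Lemma two_smallest_first_degrees (R : realType) (f : Sxyz R) d1 d2 :
  two_smallest_degrees f d1 d2 -> @first_degrees R[i] f d1 d2.
Proof.
move=> [ds [sorted_ds [r [r_syz r_homog r_gen r_min]]]].
exact: (@minimal_generators_first_degrees R[i] f d1 d2 ds r sorted_ds r_syz r_homog r_gen r_min).
Qed.

Section Points.
Variable R : realType.
Implicit Types (f : Sxyz R) (P : P2 R).

Definition rep P : 'I_3 -> R[i] := vpick (val P) 0.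

Lemma rep_neq0 P : exists i, rep P i != 0.
Proof.
have : vpick (val P) != 0 by rewrite vpick0 -dimv_eq0 (eqP (valP P)).
by move/rV0Pn.
Qed.

Lemma line_dim (w : 'I_3 -> R[i]) j : w j != 0 -> \dim <[\row_i w i]> == 1%N.
Proof.
move=> wj; rewrite dim_vline.
suff -> : (\row_i w i) != 0 by [].
by apply: contraNneq wj => /rowP/(_ j); rewrite !mxE => /eqP.
Qed.

Lemma mem_point P (v : 'rV[R[i]]_3) : v \in val P -> exists k, forall i, v 0 i = k * rep P i.
Proof.
have -> : val P = <[vpick (val P)]>%VS.
  apply/esym/eqP; rewrite eqEdim -memvE memv_pick dim_vline (eqP (valP P)).
  by rewrite vpick0 -dimv_eq0 (eqP (valP P)).
by case/vlineP => k ->; exists k => i; rewrite mxE.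
Qed.

Lemma vanishes_line n f w j (wj : w j != 0) : f \is n.-homog -> f.@[w] = 0 ->
  vanishes_at f (Sub <[\row_i w i]>%VS (line_dim wj)).
Proof.
move=> fn fw v; rewrite SubK => /vlineP[k ->].
by rewrite (@meval_homog R[i] n f k w) ?fw ?mulr0 // => i; rewrite !mxE.
Qed.

Lemma rep_on_curve n f P : f \is n.-homog -> vanishes_at f P -> f.@[rep P] = 0.
Proof. by move=> fn; apply; apply: memv_pick. Qed.

Lemma rep_cross_neq0 P Q : P != Q -> exists k, cross (rep P) (rep Q) k != 0.
Proof.
move=> ne_PQ; have [//|no_k] := boolP [exists k, cross (rep P) (rep Q) k != 0].
  by move/existsP.
have [j qj] := rep_neq0 Q; case/eqP: ne_PQ.
have [|k pE] := @cross_eq0_proportional R[i] (rep P) (rep Q) j qj.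
  by move=> l; apply/eqP; move/existsPn/(_ l): no_k; rewrite negbK.
apply: val_inj; apply/eqP; rewrite eqEdim (eqP (valP P)) (eqP (valP Q)) andbT.
apply/subvP => v /mem_point[k' vE].
suff -> : v = (k' * k) *: vpick (val Q) by rewrite memvZ ?memv_pick.
by apply/rowP => l; rewrite mxE vE pE mulrA.
Qed.

(** Otherwise the line spanned by w is a singular point. *)
Lemma smooth_gradient n f w j : smooth_curve n f -> w j != 0 -> f.@[w] = 0 ->
  exists i, @gradient_at R[i] f w i != 0.
Proof.
move=> [[_ fn _ _] smooth] wj fw.
have [/existsP//|no_i] := boolP [exists i, @gradient_at R[i] f w i != 0].
case: (smooth (Sub <[\row_i w i]>%VS (line_dim wj))); split.
  exact: vanishes_line fn fw.
move=> l; apply: (@vanishes_line n.-1); first exact: (@mderiv_homog R[i]).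
by apply/eqP; move/existsPn/(_ l): no_i; rewrite negbK.
Qed.

End Points.

Lemma first_degrees_of_union (R : realType) (n1 n2 : nat) (f1 f2 : Sxyz R)
    (C1_reduced : reduced_curve n1 f1)
    (C2_smooth : smooth_curve n2 f2)
    (C1_meets_C2 : meet_in_points f1 f2 (n1 * n2)%N)
    (d1 d2 : nat)
    (d1_d2 : two_smallest_degrees f1 d1 d2)
    (d2_bound : (d2 + 2 <= n1)%N) :
  @first_degrees R[i] (f1 * f2) (d1 + n2) (d2 + n2).
Proof.
have [n1_gt0 f1n f1_neq0 _] := C1_reduced.
have [n2_gt0 f2n f2_neq0 _] := C2_smooth.1.
have [s [s_uniq s_size s_all]] := C1_meets_C2.
pose pt (k : 'I_(n1 * n2)) : P2 R := tnth (Tuple (introT eqP s_size)) k.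
have pt_in k : pt k \in s by apply: mem_tnth.
pose ps k := rep (pt k).
have ps_zero k : f1.@[ps k] = 0 /\ f2.@[ps k] = 0.
  have [P1 P2'] := (s_all (pt k)).1 (pt_in k).
  by split; [apply: rep_on_curve f1n P1|apply: rep_on_curve f2n P2'].
have ps_neq0 k : exists j, ps k j != 0 by apply: rep_neq0.
have ps_uniq k l : k != l -> exists m, cross (ps k) (ps l) m != 0.
  move=> ne_kl; apply: rep_cross_neq0; apply: contraNneq ne_kl.
  by rewrite /pt !(tnth_nth (pt k)) /= => /eqP; rewrite nth_uniq ?s_size.
have ps_all w j : w j != 0 -> f1.@[w] = 0 -> f2.@[w] = 0 ->
    exists k c, forall l, w l = c * ps k l.
  move=> wj f1w f2w; pose P : P2 R := Sub <[\row_i w i]>%VS (line_dim wj).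
  have sP : P \in s.
    by apply/s_all; split; [apply: vanishes_line f1n f1w|apply: vanishes_line f2n f2w].
  have lt_P : (index P s < n1 * n2)%N by rewrite -s_size index_mem.
  exists (Ordinal lt_P).
  have -> : ps (Ordinal lt_P) = rep P by rewrite /ps /pt (tnth_nth P) /= nth_index.
  have [|c wE] := @mem_point R P (\row_i w i); first by rewrite SubK memv_line.
  by exists c => l; rewrite -wE mxE.
have K_char0 k : (k%:R == 0 :> R[i]) = (k == 0)%N by rewrite pnatr_eq0.
apply: (@first_degrees_union R[i] n1 n2 f1 f2) => //.
- exact: (@free_line_cancel R[i] n1 n2 f1 f2 ps).
- move=> v j vj f2v.
  apply: (@transversal R[i] n1 n2 f1 f2 ps _ _ _ _ _ _ _ _ _ _ v j) => //.
  exact: smooth_gradient C2_smooth vj f2v.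
exact: two_smallest_first_degrees.
Qed.

Theorem theorem1p7 (R : realType) (n1 n2 : nat) (f1 f2 : Sxyz R)
    (C1_reduced : reduced_curve n1 f1)
    (C2_smooth : smooth_curve n2 f2)
    (C1_meets_C2 : meet_in_points f1 f2 (n1 * n2)%N)
    (d1 d2 : nat)
    (d1_d2 : two_smallest_degrees f1 d1 d2)
    (d2_bound : (d2 + 2 <= n1)%N) :
  (forall t1 t : int,
     has_type n1 f1 t1 -> has_type (n1 + n2)%N (f1 * f2) t ->
     t = t1 + n2%:Z) /\
  (forall d1' d2' : nat,
     two_smallest_degrees (f1 * f2) d1' d2' ->
     [/\ d1' = (d1 + n2)%N, d2' = (d2 + n2)%N & (d2' + 2 <= n1 + n2)%N]).
Proof.
have union_deg := first_degrees_of_union C1_reduced C2_smooth C1_meets_C2 d1_d2 d2_bound.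
have degE d1' d2' : two_smallest_degrees (f1 * f2) d1' d2' ->
    d1' = (d1 + n2)%N /\ d2' = (d2 + n2)%N.
  by move/two_smallest_first_degrees/first_degrees_uniq; apply.
split=> [t1 t [e1 [e2 [e12 ->]]] [e1' [e2' [/degE[-> ->] ->]]]|d1' d2' /degE[-> ->]].
  have [-> ->] := first_degrees_uniq (two_smallest_first_degrees e12)
    (two_smallest_first_degrees d1_d2).
  lia.
by split=> //; lia.
Qed.
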